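(* Assume the Linearization Conjecture and the Torus Conjecture (both stated in the context, for the given $n$ and $L$). Let $\mu=(\mu^{(1)},\ldots,\mu^{(n)})$ satisfy $p^{(a)}_i\ge1$ for all $(a,i)\in\overline H$. Then, with $$\Omega(\mu)=(\det F)\prod_{(a,i)\in\overline H}\frac{1}{m^{(a)}_i}\binom{p^{(a)}_i+m^{(a)}_i-1}{m^{(a)}_i-1},$$ one has $$|{\mathcal P}(\mu)|=\Omega(\mu)=\sum_{\boldsymbol\gamma}\det F_{\boldsymbol\gamma}\prod_{(a,i)\in\overline H}\frac{\bigl|\Lambda_{\gamma^{(a)}_i}(m^{(a)}_i,p^{(a)}_i)\bigr|}{m^{(a)}_i/\gamma^{(a)}_i},$$ where the sum is over all arrays $\boldsymbol\gamma=(\gamma^{(a)}_i)_{(a,i)\in\overline H}$ such that each $\gamma^{(a)}_i$ is a common (positive) divisor of $m^{(a)}_i$ and $p^{(a)}_i$. Here, in the term for $\boldsymbol\gamma$, $\det F_{\boldsymbol\gamma}$ is the size of a ${\mathcal T}$-orbit in ${\mathcal P}_{\boldsymbol\gamma}(\mu)$ and the product over $\overline H$ is the number of ${\mathcal T}$-orbits in ${\mathcal P}_{\boldsymbol\gamma}(\mu)$.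
   Context: Fix integers $n\ge 1$, $L\ge 1$. For $1\le r\le n$, $l\ge 1$, let $B^{r,l}$ be the set of semistandard tableaux of rectangular shape with $r$ rows and $l$ columns and entries in $\{1,\ldots,n+1\}$; so $B^{1,1}=\{1,\ldots,n+1\}$. For a semistandard tableau $T$ and a letter $x$, $T\leftarrow x$ denotes Schensted row insertion ($x$ bumps the smallest entry of the first row strictly larger than $x$, the bumped entry is inserted into the next row, and so on; if there is no such entry the letter is appended at the end of the row), and $x\rightarrow T$ denotes column insertion ($x$ bumps the smallest entry of the first column that is $\ge x$, the bumped entry is inserted into the next column, and so on; if there is no such entry the letter is appended at the bottom of the column). The combinatorial $R$ is the bijection $R:B^{r,l}\otimes B^{1,1}\to B^{1,1}\otimes B^{r,l}$ ($\otimes$ is a formal Cartesian product) determined by $R(b\otimes c)=c'\otimes b'$ iff $(c\rightarrow b)=(b'\leftarrow c')$; we also write $b\otimes c\simeq c'\otimes b'$. The local energy $H(b\otimes c)$ is $0$ if this common tableau has shape $(l+1,l^{r-1})$ and $1$ if it has shape $(l^r,1)$. A path is an element $p=b_1\otimes\cdots\otimes b_L$ of $B=(B^{1,1})^{\otimes L}$, also written as a word $b_1\ldots b_L$. For $v\in B^{r,l}$ put $v_0=v$ and recursively $v_{k-1}\otimes b_k\simeq b'_k\otimes v_k$, $e_k=H(v_{k-1}\otimes b_k)$ for $k=1,\ldots,L$; write $v'(v;p)=v_L$, $p'(v;p)=b'_1\otimes\cdots\otimes b'_L$, $e_k(v;p)=e_k$. The path $p$ is $T^{(r)}_l$-evolvable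 if there is $v\in B^{r,l}$ with $v=v'(v;p)$ and, moreover, $p'(v;p)$ and all $e_k(v;p)$ are the same for all such $v$. Then $T^{(r)}_l(p)=p'(v;p)$ and $E^{(r)}_l(p)=\sum_{k=1}^L e_k(v;p)$. A path is evolvable if it is $T^{(r)}_l$-evolvable for all $1\le r\le n$, $l\ge1$. For an $n$-tuple of Young diagrams $\mu=(\mu^{(1)},\ldots,\mu^{(n)})$, let $l^{(a)}_1>\cdots>l^{(a)}_{g_a}\ge 1$ be the distinct row lengths of $\mu^{(a)}$ and $m^{(a)}_i\ge1$ the number of rows of length $l^{(a)}_i$. Put $\overline H=\{(a,i)\mid 1\le a\le n,\ 1\le i\le g_a\}$, $g=|\overline H|$. Let $(C_{ab})_{1\le a,b\le n}$, $C_{ab}=2\delta_{ab}-\delta_{a,b+1}-\delta_{a,b-1}$, be the Cartan matrix of $A_n$. The vacancy numbers are $p^{(a)}_i=L\delta_{a1}-\sum_{(b,j)\in\overline H}C_{ab}\min(l^{(a)}_i,l^{(b)}_j)m^{(b)}_j$. The $g\times g$ matrix $F=(F_{ai,bj})$ is $F_{ai,bj}=\delta_{ab}\delta_{ij}p^{(a)}_i+C_{ab}\min(l^{(a)}_i,l^{(b)}_j)m^{(b)}_j$, and for $\boldsymbol\gamma=(\gamma^{(a)}_i)_{(a,i)\in\overline H}$, with each $\gamma^{(a)}_i$ a common divisor of $m^{(a)}_i$ and $p^{(a)}_i$, $F_{\boldsymbol\gamma}=(F_{ai,bj}/\gamma^{(b)}_j)$. A path is highest if for every $1\le j\le L$ the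 prefix $b_1\ldots b_j$ satisfies $\#(1)\ge\#(2)\ge\cdots\ge\#(n+1)$, where $\#(a)$ is the number of letters $a$. ${\mathcal P}(\mu)$ is the set of evolvable paths $p$ with $\#(1)\ge\#(2)\ge\cdots\ge\#(n+1)$ and $E^{(a)}_l(p)=\sum_{i=1}^{g_a}\min(l,l^{(a)}_i)m^{(a)}_i$ for all $1\le a\le n$, $l\ge1$; ${\mathcal P}_+(\mu)$ is the set of highest paths in ${\mathcal P}(\mu)$. A rigged configuration $(\mu,{\bf r})$ is $\mu$ with an integer array ${\bf r}=(r^{(a)}_{i,\alpha})$, $(a,i)\in\overline H$, $1\le\alpha\le m^{(a)}_i$, with $0\le r^{(a)}_{i,1}\le\cdots\le r^{(a)}_{i,m^{(a)}_i}\le p^{(a)}_i$; $\mathrm{RC}(\mu)$ is the set of these. It is viewed as a multiset of strings (color $a$, length $l^{(a)}_i$, rigging $r^{(a)}_{i,\alpha}$). A string is singular if its rigging equals the vacancy number $p^{(a)}_i$. The KKR map $\phi$ from highest paths to rigged configurations is defined by induction on $L$. For $L=0$ the image is empty. Given $\phi(b_1\ldots b_L)$ and $d=b_{L+1}$: if $d=1$, the strings are unchanged (only $L$ is replaced by $L+1$). If $d\ge2$, set $\ell^{(d)}=\infty$ and for $c=d-1,\ldots,1$ in this order select a color $c$ singular string (with respect to the old configuration and $L$) whose length $\ell^{(c)}$ is largest subject to $\ell^{(c)}\le\ell^{(c+1)}$ (any one if several; if none, $\ell^{(c)}=0$). For each $c=1,\ldots,d-1$ replace the selected string by a color $c$ string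 of length $\ell^{(c)}+1$ (a new length $1$ string if $\ell^{(c)}=0$), with rigging making it singular with respect to the new configuration and $L+1$; other strings are unchanged. One knows $\phi({\mathcal P}_+(\mu))\subseteq\mathrm{RC}(\mu)$. Let $\tilde{\mathcal J}(\mu)$ be the set of integer arrays $(r^{(a)}_{i,\alpha})_{(a,i)\in\overline H,\alpha\in{\mathbb Z}}$ with $r^{(a)}_{i,\alpha}\le r^{(a)}_{i,\alpha+1}$ and $r^{(a)}_{i,\alpha+m^{(a)}_i}=r^{(a)}_{i,\alpha}+p^{(a)}_i$. Let $\iota:{\mathcal P}_+(\mu)\to\tilde{\mathcal J}(\mu)$ send $p_+$ with $\phi(p_+)=(\mu,{\bf r})$ to the unique quasi-periodic extension of ${\bf r}$ in $\tilde{\mathcal J}(\mu)$. Let ${\mathcal T}$ be the abelian group generated by all $T^{(a)}_l$ ($1\le a\le n$, $l\ge1$) and ${\mathcal A}$ the free abelian group generated by symbols $s^{(a)}_i$, $(a,i)\in\overline H$. They act (commutatively) on $\tilde{\mathcal J}(\mu)$ by $T^{(a)}_l:(r^{(b)}_{j,\beta})\mapsto(r^{(b)}_{j,\beta}+\delta_{ab}\min(l,l^{(b)}_j))$ and $s^{(a)}_i:(r^{(b)}_{j,\beta})\mapsto(r^{(b)}_{j,\beta+\delta_{ab}\delta_{ij}}+C_{ab}\min(l^{(a)}_i,l^{(b)}_j))$. Put ${\mathcal J}(\mu)=\tilde{\mathcal J}(\mu)/{\mathcal A}$ (set of ${\mathcal A}$-orbits), on which ${\mathcal T}$ acts. Linearization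 Conjecture: for every $\mu$ with $p^{(a)}_i\ge1$ for all $(a,i)\in\overline H$: (1) $T^{(r)}_l({\mathcal P}(\mu))={\mathcal P}(\mu)$ for all $r,l$ (so ${\mathcal T}$ acts on ${\mathcal P}(\mu)$); (2) every ${\mathcal T}$-orbit $\Sigma(p)$, $p\in{\mathcal P}(\mu)$, meets ${\mathcal P}_+(\mu)$; (3) the map $\Phi:{\mathcal P}(\mu)\to{\mathcal J}(\mu)$, $\Phi(p)={\mathcal A}\cdot(t\cdot\iota(p_+))$ whenever $p=t\cdot p_+$ with $t\in{\mathcal T}$, $p_+\in{\mathcal P}_+(\mu)$, is well-defined, bijective and commutes with ${\mathcal T}$. For $m\ge1,p\ge0$ let $\Lambda(m,p)$ be the set of integer sequences $(\lambda_\alpha)_{\alpha\in{\mathbb Z}}$ with $\lambda_1=0$, $\lambda_\alpha\le\lambda_{\alpha+1}$, $\lambda_{\alpha+m}=\lambda_\alpha+p$; for a common divisor $\gamma$ of $m,p$ let $\Lambda_\gamma(m,p)$ be the set of $\lambda\in\Lambda(m/\gamma,p/\gamma)$ with $\lambda\notin\Lambda(m/\gamma',p/\gamma')$ for every common divisor $\gamma'>\gamma$ of $m,p$. Identify $\tilde{\mathcal J}(\mu)$ with $X={\mathbb Z}^g\times\prod_{(a,i)\in\overline H}\Lambda(m^{(a)}_i,p^{(a)}_i)$ by $(r^{(a)}_{i,\alpha})\leftrightarrow(\omega,\boldsymbol\lambda)$, $\omega^{(a)}_i=r^{(a)}_{i,1}$, $\lambda^{(a)}_{i,\alpha}=r^{(a)}_{i,\alpha}-r^{(a)}_{i,1}$,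 so ${\mathcal J}(\mu)=X/{\mathcal A}$. Put $X_{\boldsymbol\gamma}={\mathbb Z}^g\times\prod_{(a,i)\in\overline H}\Lambda_{\gamma^{(a)}_i}(m^{(a)}_i,p^{(a)}_i)$ (stable under ${\mathcal T}$ and ${\mathcal A}$) and ${\mathcal P}_{\boldsymbol\gamma}(\mu)=\Phi^{-1}(X_{\boldsymbol\gamma}/{\mathcal A})$. The group ${\mathcal T}$ acts on ${\mathbb Z}^g/F_{\boldsymbol\gamma}{\mathbb Z}^g$ by $T^{(r)}_l({\mathcal I})={\mathcal I}+h^{(r)}_l$, $h^{(r)}_l=(\delta_{rb}\min(l,l^{(b)}_j))_{(b,j)\in\overline H}$. For $x=(\omega,\boldsymbol\lambda)\in X_{\boldsymbol\gamma}$ let $\chi:{\mathcal T}\cdot({\mathcal A}\cdot x)\to{\mathbb Z}^g/F_{\boldsymbol\gamma}{\mathbb Z}^g$, $t\cdot({\mathcal A}\cdot x)\mapsto t\cdot\omega \bmod F_{\boldsymbol\gamma}{\mathbb Z}^g$, where $T^{(r)}_l\cdot\omega=\omega+h^{(r)}_l$ (this is a known well-defined map). Torus Conjecture: for every such $\mu$ and any $p\in{\mathcal P}_{\boldsymbol\gamma}(\mu)$, with $x$ chosen so that $\Phi(p)={\mathcal A}\cdot x$, the map $\chi\circ\Phi$ is a bijection $\Sigma(p)\to{\mathbb Z}^g/F_{\boldsymbol\gamma}{\mathbb Z}^g$ commuting with ${\mathcal T}$. *)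

(* Defs.v *)
(* Letters, colors and time evolution labels are shifted by one:
   the letter x in {1, ..., n+1} is the ordinal x - 1 : 'I_n.+1, the color a
   in {1, ..., n} is a - 1 : 'I_n, and T^(r)_l, E^(r)_l with 1 <= r <= n and
   l >= 1 are indexed by the pair (r - 1, l - 1) : 'I_n * nat. *)
From HB Require Import structures.
From mathcomp Require Import all_boot all_order all_algebra.
From mathcomp Require Import finmap.
From mathcomp Require Import boolp classical_sets functions cardinality fsbigop.
From mathcomp Require Import freeg.

Set Implicit Arguments.
Unset Strict Implicit.
Unset Printing Implicit Defensive.

Import Order.TTheory GRing.Theory Num.Theory.

Local Open Scope classical_set_scope.
Local Open Scope ring_scope.

(* 0 when A is infinite; only used on finite sets. *)
Definition set_card (T : choiceType) (A : set T) : nat := #|` fset_set A|.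

Section Tableaux.
Variable n : nat.
Local Notation letter := 'I_n.+1.

(* A tableau is the list of its rows, from top to bottom. *)
Definition tableau := seq (seq letter).

Definition transpose (T : tableau) : tableau :=
  [seq [seq nth ord0 row j | row <- T & (j < size row)%N]
     | j <- iota 0 (size (head [::] T))].

(* x replaces the first entry y of the first line such that bump x y, and y is
   inserted into the next line; without such an entry x is appended. *)
Fixpoint insert (bump : rel letter) (T : tableau) (x : letter) : tableau :=
  if T is line :: T' then
    let i := find (bump x) line in
    if (i < size line)%N
    then set_nth ord0 line i x :: insert bump T' (nth ord0 line i)
    else rcons line x :: T'
  else [:: [:: x]].

(* T <- x *)
Definition row_insert (T : tableau) (x : letter) : tableau :=
  insert (fun x y => (x < y)%N) T x.

(* x -> T *)
Definition column_insert (x : letter) (T : tableau) : tableau :=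
  transpose (insert (fun x y => (x <= y)%N) (transpose T) x).

(* b \in B^{r,l} *)
Definition rect_ssyt (r l : nat) (b : tableau) : bool :=
  [&& map size b == nseq r l,
      all (sorted (fun x y : letter => (x <= y)%N)) b &
      all (sorted (fun x y : letter => (x < y)%N)) (transpose b)].

(* For b in B^{r,l}: b \otimes c \simeq c' \otimes b'. *)
Definition comb_R (r l : nat) (b : tableau) (c c' : letter) (b' : tableau) :=
  rect_ssyt r l b' /\ column_insert c b = row_insert b' c'.

(* For b in B^{r,l} the shape is either (l^r, 1) or (l+1, l^{r-1}). *)
Definition local_energy (r l : nat) (b : tableau) (c : letter) : nat :=
  if map size (column_insert c b) == rcons (nseq r l) 1 then 1 else 0.

(* v' = v'(v;p), p' = p'(v;p) and e = (e_1(v;p), ..., e_L(v;p)). *)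
Fixpoint carries (r l : nat) (v : tableau) (p p' : seq letter) (e : seq nat)
    (v' : tableau) : Prop :=
  match p, p', e with
  | [::], [::], [::] => v' = v
  | b :: p1, b' :: p1', e1 :: es =>
      exists w, [/\ comb_R r l v b b' w, e1 = local_energy r l v b
                  & carries r l w p1 p1' es v']
  | _, _, _ => False
  end.

End Tableaux.

Section Paths.
Variables n L : nat.

Definition lpath := L.-tuple 'I_n.+1.

(* The pairs (p'(v;p), (e_k(v;p))_k) for the v \in B^{a+1,k+1} such that
   v = v'(v;p). *)
Definition outcomes (a : 'I_n) (k : nat) (p : lpath) : set (lpath * seq nat) :=
  [set o : lpath * seq nat | exists v, rect_ssyt a.+1 k.+1 v /\
                     carries a.+1 k.+1 v p o.1 o.2 v].

Definition evolvable_for (a : 'I_n) (k : nat) (p : lpath) : Prop :=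
  exists! o, outcomes a k p o.

Definition evolvable (p : lpath) : Prop := forall a k, evolvable_for a k p.

Definition outcome a k (p : lpath) := xget (p, [::]) (outcomes a k p).

(* T^(a+1)_(k+1) and E^(a+1)_(k+1); meaningful when evolvable_for a k p. *)
Definition evolution a k (p : lpath) : lpath := (outcome a k p).1.
Definition energy a k (p : lpath) : nat := sumn (outcome a k p).2.

(* #(1) >= #(2) >= ... >= #(n+1) *)
Definition dominant (w : seq 'I_n.+1) : bool :=
  sorted geq [seq count_mem x w | x <- enum 'I_n.+1].

Definition highest (p : lpath) : Prop :=
  forall j, (1 <= j <= L)%N -> dominant (take j p).

End Paths.

Definition cartan (a b : nat) : int :=
  (a == b)%:Z *+ 2 - (a == b.+1)%:Z - (a.+1 == b)%:Z.

Section KKR.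

(* ((color, length), rigging); a configuration is a list of strings that stands
   for a multiset. *)
Definition string := (nat * nat * int)%type.

(* Vacancy number of color a and length l, from the list of the
   (color, length) of all strings. *)
Definition kkr_vacancy (L : nat) (sh : seq (nat * nat)) (a l : nat) : int :=
  (if a == 0%N then L%:Z else 0) -
  \sum_(s <- sh) cartan a s.1 * (minn l s.2)%:Z.

Definition singular (L : nat) (S : seq string) (s : string) : bool :=
  s.2 == kkr_vacancy L [seq u.1 | u <- S] s.1.1 s.1.2.

(* The (c, ell^(c)) for c = d-1, ..., 0.  The bound ell^(c+1) is None when
   infinite.  Strings have positive length, so that the maximum is 0 exactly
   when there is no string to select.  Selectable strings of the same color and
   length also have the same rigging: the choice among them is immaterial. *)
Fixpoint kkr_lengths (L : nat) (S : seq string) (d : nat) (bound : option nat)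
    : seq (nat * nat) :=
  if d is c.+1 then
    let ell := (\max_(s <- S | [&& s.1.1 == c, singular L S s
                   & if bound is Some m then (s.1.2 <= m)%N else true]) s.1.2)%N
    in (c, ell) :: kkr_lengths L S c (Some ell)
  else [::].

(* The letter d is already shifted, so that the colors involved are
   d - 1, ..., 0.  When ell^(c) = 0, rem removes nothing. *)
Definition kkr_step (L : nat) (S : seq string) (d : nat) : seq string :=
  let ells := kkr_lengths L S d None in
  let sh := [seq s.1 | s <- S] in
  let kept :=
    foldl (fun U cl => rem (cl, kkr_vacancy L sh cl.1 cl.2) U) S ells in
  let grown := [seq (cl.1, cl.2.+1) | cl <- ells] in
  let sh' := [seq s.1 | s <- kept] ++ grown in
  kept ++ [seq (cl, kkr_vacancy L.+1 sh' cl.1 cl.2) | cl <- grown].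

(* The state is (configuration, number of letters already read). *)
Definition kkr n (p : seq 'I_n.+1) : seq string :=
  (foldl (fun SL (d : 'I_n.+1) => (kkr_step SL.2 SL.1 d, SL.2.+1))
     ([::], 0%N) p).1.

End KKR.

Record diagram := Diagram {
  rows :> seq nat;
  rowsP : sorted geq rows && (0%N \notin rows)
}.

Section Configuration.
Variables (n L : nat) (mu : 'I_n -> diagram).

(* Since mu a is sorted, undup lists its distinct row lengths in decreasing
   order. *)
Definition Hbar : finType := {a : 'I_n & 'I_(size (undup (mu a)))}.

Definition color (h : Hbar) : 'I_n := tag h.
Definition len (h : Hbar) : nat := nth 0%N (undup (mu (color h))) (tagged h).
Definition mult (h : Hbar) : nat := count_mem (len h) (mu (color h)).

Definition Cmin (h k : Hbar) : int :=
  cartan (color h) (color k) * (minn (len h) (len k))%:Z.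

Definition vacancy (h : Hbar) : int :=
  (if color h == 0%N :> nat then L%:Z else 0) -
  \sum_(k : Hbar) Cmin h k * (mult k)%:Z.

(* Natural number form of the vacancy numbers, used where they are assumed to
   be nonnegative. *)
Definition nvacancy (h : Hbar) : nat := `|vacancy h|%N.

(* Z^g and g x g matrices are indexed by 'I_#|Hbar| through enum_val. *)
Local Notation lattice := 'cV[int]_#|Hbar|.

Definition Fcoef (h k : Hbar) : int :=
  (h == k)%:Z * vacancy h + Cmin h k * (mult k)%:Z.

Definition Fmx : 'M[int]_#|Hbar| :=
  \matrix_(i, j) Fcoef (enum_val i) (enum_val j).

(* The arrays gamma of positive common divisors. *)
Definition divisor_arrays : set {ffun Hbar -> nat} :=
  [set gam | forall h, [/\ (0 < gam h)%N, (gam h %| mult h)%N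
                         & (gam h %| nvacancy h)%N]].

(* The divisions are exact for gam in divisor_arrays. *)
Definition Fgamma (gam : {ffun Hbar -> nat}) : 'M[int]_#|Hbar| :=
  \matrix_(i, j) (Fcoef (enum_val i) (enum_val j) %/ (gam (enum_val j))%:Z)%Z.

Local Notation lpath := (lpath n L).

Definition Pset : set lpath :=
  [set p | [/\ evolvable p, dominant p &
     forall a k, energy a k p =
       (\sum_(h : Hbar | color h == a) minn k.+1 (len h) * mult h)%N]].

Definition Pplus : set lpath := Pset `&` [set p | highest p].

(* The array (r^(a)_{i,alpha}) for alpha in Z. *)
Definition array := Hbar -> int -> int.

Definition Jtilde : set array :=
  [set r | forall h (al : int), r h al <= r h (al + 1) /\
                        r h (al + (mult h)%:Z) = r h al + vacancy h].

(* r^(a)_{i,1} <= ... <= r^(a)_{i,m} *)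
Definition riggings (p : lpath) (h : Hbar) : seq int :=
  sort <=%R [seq s.2 | s <- kkr p & s.1 == (color h : nat, len h)].

(* Quasi-periodic extension: r_(1 + i + q m) = r_(1 + i) + q p, 0 <= i < m. *)
Definition iota_map (p : lpath) : array := fun h al =>
  nth 0 (riggings p h) `|((al - 1) %% (mult h)%:Z)%Z|%N +
  ((al - 1) %/ (mult h)%:Z)%Z * vacancy h.

(* The group T, and its action on Z^g. *)
Definition Tgroup := {freeg ('I_n * nat)%type}.

Definition hvec (ak : 'I_n * nat) : lattice :=
  \col_i (if color (enum_val i) == ak.1
          then (minn ak.2.+1 (len (enum_val i)))%:Z else 0).

Definition Tshift (t : Tgroup) : lattice :=
  \sum_(ak <- dom t) coeff ak t *: hvec ak.

Definition Tact_array (t : Tgroup) (r : array) : array :=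
  fun h be => r h be + Tshift t (enum_rank h) 0.

(* Action on P(mu), as a relation: q = t . p. *)
Inductive Tact_path : Tgroup -> lpath -> lpath -> Prop :=
| Tact_one p : Pset p -> Tact_path 0 p p
| Tact_gen t p q a k : Tact_path t p q ->
    Tact_path (t + << (a, k) >>) p (evolution a k q)
| Tact_inv t p q a k : Pset q -> Tact_path t p (evolution a k q) ->
    Tact_path (t - << (a, k) >>) p q.

Definition Torbit (p : lpath) : set lpath := [set q | exists t, Tact_path t p q].

(* The element \sum_h s h * s^(a)_i of the free abelian group A acts by the
   composition of the actions of the generators. *)
Definition Agroup := {ffun Hbar -> int}.

Definition Aact (s : Agroup) (r : array) : array :=
  fun h be => r h (be + s h) + \sum_(k : Hbar) s k * Cmin k h.

Definition Aorbit (r : array) : set array := [set Aact s r | s in setT].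

(* J(mu), a set of A-orbits, and the action of T on A-orbits. *)
Definition Jset : set (set array) := Aorbit @` Jtilde.

Definition Tact_orbit (t : Tgroup) (O : set array) : set array :=
  Tact_array t @` O.

(* The union of all A . (t . iota p+) such that p = t . p+; that this is the
   A-orbit of each single t . iota p+ is the well-definedness part of the
   Linearization Conjecture. *)
Definition Phi (p : lpath) : set array :=
  [set y | exists t p0, [/\ Pplus p0, Tact_path t p0 p
                          & Aorbit (Tact_array t (iota_map p0)) y]].

Definition linearization_for : Prop :=
  [/\ (forall a k, evolution a k @` Pset = Pset),
      (forall p, Pset p -> (Torbit p `&` Pplus) !=set0),
      (forall t p0 p, Pplus p0 -> Tact_path t p0 p ->
         Phi p = Aorbit (Tact_array t (iota_map p0))),
      set_bij Pset Jset Phi &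
      (forall t p q, Tact_path t p q -> Phi q = Tact_orbit t (Phi p))].

Definition Lambda (m p : nat) : set (int -> int) :=
  [set la | [/\ la 1 = 0, (forall al, la al <= la (al + 1))
              & (forall al, la (al + m%:Z) = la al + p%:Z)]].

Definition Lambda_gamma (g m p : nat) : set (int -> int) :=
  [set la | Lambda (m %/ g) (p %/ g) la /\
     forall g', (g < g')%N -> (g' %| m)%N -> (g' %| p)%N ->
       ~ Lambda (m %/ g') (p %/ g') la].

(* Coordinates (omega, lambda) identifying Jtilde with X. *)
Definition omega (r : array) : lattice := \col_i r (enum_val i) 1.
Definition lambda (r : array) (h : Hbar) : int -> int :=
  fun al => r h al - r h 1.

Definition Xgamma (gam : {ffun Hbar -> nat}) : set array :=
  [set r | Jtilde r /\
     forall h, Lambda_gamma (gam h) (mult h) (nvacancy h) (lambda r h)].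

Definition Pgamma (gam : {ffun Hbar -> nat}) : set lpath :=
  [set p | Pset p /\ (Aorbit @` Xgamma gam) (Phi p)].

(* The class of u in Z^g / F_gamma Z^g. *)
Definition coset (gam : {ffun Hbar -> nat}) (u : lattice) : set lattice :=
  [set u + Fgamma gam *m z | z in setT].

Definition torus gam : set (set lattice) := coset gam @` setT.

Definition Tact_torus (t : Tgroup) (I : set lattice) : set lattice :=
  [set u + Tshift t | u in I].

(* The map chi attached to x, on T . (A . x).  It is written as a union over
   all t such that O = t . (A . x); the class does not depend on t. *)
Definition chi gam (x : array) (O : set array) : set lattice :=
  [set u | exists2 t, O = Tact_orbit t (Aorbit x)
                    & coset gam (omega x + Tshift t) u].

Definition torus_for : Prop :=
  forall gam, divisor_arrays gam ->
  forall p x, Pgamma gam p -> Xgamma gam x -> Phi p = Aorbit x ->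
    set_bij (Torbit p) (torus gam) (fun q => chi gam x (Phi q)) /\
    (forall t q q', Torbit p q -> Tact_path t q q' ->
       chi gam x (Phi q') = Tact_torus t (chi gam x (Phi q))).

Definition Omega : rat :=
  (\det Fmx)%:~R *
  \prod_(h : Hbar)
    ((mult h)%:R^-1 *
     'C((nvacancy h + mult h).-1, (mult h).-1)%:R).

(* The claimed number of T-orbits in P_gamma(mu). *)
Definition orbit_count (gam : {ffun Hbar -> nat}) : rat :=
  \prod_(h : Hbar)
    ((set_card (Lambda_gamma (gam h) (mult h) (nvacancy h)))%:R /
     ((mult h)%:R / (gam h)%:R)).

End Configuration.

Arguments divisor_arrays {n} L mu.
Arguments Pset {n} L mu.
Arguments Pplus {n} L mu.
Arguments Torbit {n} L mu.
Arguments Phi {n} L mu.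
Arguments Pgamma {n} L {mu} gam.

Definition positive_vacancies n L (mu : 'I_n -> diagram) : Prop :=
  forall h : Hbar mu, 1 <= vacancy L h.

Definition linearization_conjecture (n L : nat) : Prop :=
  forall mu : 'I_n -> diagram, positive_vacancies L mu ->
    linearization_for L mu.

Definition torus_conjecture (n L : nat) : Prop :=
  forall mu : 'I_n -> diagram, positive_vacancies L mu -> torus_for L mu.

(* Main.v *)
(* P(mu) is in bijection with X/A, and T acts transitively on the translation
   part Z^g of X.  Hence the T-orbits in P_gamma(mu) correspond to the families
   (lambda^(a)_i) in the product of the Lambda_gamma(m, p) up to independent
   cyclic shifts; on Lambda_gamma(m, p) these shifts are a free action of the
   cyclic group of order m/gamma, which counts the orbits.  By the Torus
   Conjecture an orbit has [Z^g : F_gamma Z^g] = |det F_gamma| elements, read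
   off the Smith normal form.  The determinants are positive because F is, up to
   scaling the rows by the m^(a)_i, the sum of a positive diagonal matrix and of
   the Gram matrix with entries C_ab min(l, l') m m'.  The sum over gamma is
   evaluated by det F_gamma = det F / prod gamma and by the partition of
   Lambda(m, p), which has binom(p + m - 1, m - 1) elements, into the
   Lambda_gamma(m, p). *)
Require Import Defs.
From HB Require Import structures.
From mathcomp Require Import all_boot all_order all_algebra.
From mathcomp Require Import finmap.
From mathcomp Require Import boolp classical_sets functions cardinality fsbigop.
From mathcomp Require Import freeg.
From mathcomp Require Import zify ring.

Set Implicit Arguments.
Unset Strict Implicit.
Unset Printing Implicit Defensive.

Import Order.TTheory GRing.Theory Num.Theory.

Local Open Scope classical_set_scope.
Local Open Scope ring_scope.

(** * Cardinals of finite sets *)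

Section SetCard.

Lemma set_card_image (T U : choiceType) (f : T -> U) (A : set T) :
  finite_set A -> {in A &, injective f} -> set_card (f @` A) = set_card A.
Proof.
move=> finA injf; apply/(fcard_eq (finite_image _ finA) finA).
exact: inj_card_eq.
Qed.

Lemma set_card_bij (T U : choiceType) (f : T -> U) (A : set T) (B : set U) :
  finite_set A -> set_bij A B f -> set_card A = set_card B.
Proof.
move=> finA [fAB injf surjf].
have -> : B = f @` A by apply/seteqP; split=> // y [x Ax <-]; exact: fAB.
by rewrite set_card_image.
Qed.

Lemma set_card_pred (T : finType) (P : pred T) : set_card [set x | P x] = #|P|.
Proof.
rewrite /set_card cardE.
apply/perm_size/uniq_perm; [exact: fset_uniq|exact: enum_uniq|] => x.
by rewrite mem_enum (in_fset_set finite_finset); apply/idP/idP; rewrite inE.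
Qed.

Lemma set_card_range (T : finType) (U : choiceType) (f : T -> U) :
  injective f -> set_card (range f) = #|T|.
Proof.
move=> injf; have inj' : {in setT &, injective f} by move=> x y _ _; apply: injf.
rewrite (set_card_image finite_finset inj') -[RHS]set_card_pred.
by congr set_card; apply/seteqP; split.
Qed.

(** Serves to count classes: f sends x to its orbit or coset, g to a complete invariant whose values
    can be counted. Choosing a point s v over each value v makes [f \o s] a bijection between the
    two images. *)
Lemma set_card_quotient (T U V : choiceType) (f : T -> U) (g : T -> V)
    (A : set T) :
  (forall x y, A x -> A y -> f x = f y <-> g x = g y) ->
  finite_set (g @` A) ->
  finite_set (f @` A) /\ set_card (f @` A) = set_card (g @` A).
Proof.
move=> fg fing; have [->|/set0P[a0 Aa0]] := eqVneq A set0.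
  by rewrite !image_set0; split=> //; rewrite /set_card !fset_set0 !cardfs0.
pose s v := xget a0 [set x | A x /\ g x = v].
have sP x : A x -> A (s (g x)) /\ g (s (g x)) = g x.
  by move=> Ax; apply: (@xgetPex _ a0 [set y | A y /\ g y = g x]); exists x.
have -> : f @` A = (f \o s) @` (g @` A).
  rewrite image_comp; apply: eq_imagel => x Ax /=.
  by have [As gs] := sP _ Ax; apply/fg.
split; first exact: finite_image.
apply: set_card_image => // _ _ /set_mem[x Ax <-] /set_mem[y Ay <-] /=.
have [Asx gsx] := sP _ Ax; have [Asy gsy] := sP _ Ay.
by move/fg; rewrite gsx gsy; apply.
Qed.

(** Double counting of the pairs (i, x) with x in B i: each x of A lies in exactly one B i, so
    exchanging the sums leaves 1 for each x. *)
Lemma set_card_bigcup (T J : choiceType) (A : set T) (I : set J)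
    (B : J -> set T) :
  finite_set A -> finite_set I ->
  A = \bigcup_(i in I) B i ->
  (forall i j x, I i -> I j -> B i x -> B j x -> i = j) ->
  set_card A = (\sum_(i \in I) set_card (B i))%N.
Proof.
move=> finA finI AB disjB.
have BA i : I i -> B i `<=` A by move=> Ii x Bx; rewrite AB; exists i.
rewrite fsbig_finite //.
transitivity (\sum_(i <- fset_set I) \sum_(x <- fset_set A | `[< B i x >]) 1)%N;
  last first.
  rewrite big_seq [RHS]big_seq; apply: eq_bigr => i.
  rewrite in_fset_set // inE => Ii.
  rewrite sum1_count -size_filter; apply: perm_size.
  apply: uniq_perm; [by rewrite filter_uniq|exact: fset_uniq|] => x.
  have finB : finite_set (B i) by apply: sub_finite_set finA; exact: BA.
  rewrite mem_filter !in_fset_set //.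
  by apply/andP/idP => [[/asboolP Bx _]|/set_mem Bx]; [exact: mem_set|split];
    [exact/asboolP|apply: mem_set; apply: BA Bx].
rewrite (exchange_big_dep xpredT) //= /set_card -sum1_size.
rewrite big_seq [RHS]big_seq; apply: eq_bigr => x.
rewrite in_fset_set // inE => Ax.
have [i Ii Bix] : (\bigcup_(i in I) B i) x by rewrite -AB.
rewrite sum1_count (@eq_in_count _ _ (pred1 i)).
  by rewrite count_uniq_mem // in_fset_set // mem_set.
move=> j; rewrite in_fset_set // inE => Ij /=.
by apply/asboolP/eqP => [Bjx|->//]; apply: disjB Bjx Bix.
Qed.

(** The blocks, indexed by themselves, partition A, because a block is determined by any of its
    points. *)
Lemma set_card_blocks (T : choiceType) (A : set T) (B : T -> set T) (k : nat) :
  finite_set A ->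
  (forall x, A x -> B x x /\ B x `<=` A) ->
  (forall x y, A x -> B x y -> B x = B y) ->
  (forall x, A x -> set_card (B x) = k) ->
  set_card A = (set_card (B @` A) * k)%N.
Proof.
move=> finA BA eqB cardB.
have finBA : finite_set (B @` A) by exact: finite_image.
rewrite (@set_card_bigcup _ _ _ (B @` A) id) //.
- rewrite fsbig_finite // big_seq (eq_bigr (fun=> k)) => [|b]; last first.
    by rewrite in_fset_set // inE => -[x Ax <-]; apply: cardB.
  by rewrite -big_seq big_const_seq count_predT iter_addn_0 mulnC.
- apply/seteqP; split=> [x Ax|x [_ [y Ay <-] Byx]]; last exact: (BA _ Ay).2.
  by exists (B x); [exists x|exact: (BA _ Ax).1].
- move=> _ _ x [y Ay <-] [z Az <-] Byx Bzx.
  by rewrite (eqB _ _ Ay Byx) (eqB _ _ Az Bzx).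
Qed.

(** The dependent finite product [fprod] has a known cardinal; F forgets its membership proofs and
    is injective onto the set to be counted. *)
Lemma set_card_prod (I : finType) (T : choiceType) (A : I -> set T) :
  (forall i, finite_set (A i)) ->
  finite_set [set f : {ffun I -> T} | forall i, A i (f i)] /\
  set_card [set f : {ffun I -> T} | forall i, A i (f i)] =
    (\prod_i set_card (A i))%N.
Proof.
move=> finA; pose F (f : fprod (fun i => fset_set (A i))) :=
  [ffun i => val (f i)].
have -> : [set f : {ffun I -> T} | forall i, A i (f i)] = range F.
  apply/seteqP; split=> [f fA|_ [f _ <-] i]; last first.
    by rewrite ffunE; have := valP (f i); rewrite in_fset_set // inE.
  have fA' i : f i \in fset_set (A i) by rewrite in_fset_set // inE.
  exists (fprod_of_fun (fun i => [` fA' i]%fset)) => //.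
  by apply/ffunP => i; rewrite ffunE fprodE.
split; first by apply: finite_image; exact: finite_finset.
rewrite set_card_range => [|f g /ffunP fg]; last first.
  by apply/fprodP => i; apply: val_inj; have := fg i; rewrite !ffunE.
by rewrite card_fprod; apply: eq_bigr => i _; rewrite /set_card cardfE.
Qed.

Lemma set_card_int_range (k : nat) :
  finite_set [set x : int | 0 <= x < k%:Z] /\
  set_card [set x : int | 0 <= x < k%:Z] = k.
Proof.
have -> : [set x : int | 0 <= x < k%:Z] = range (fun i : 'I_k => i%:Z).
  apply/seteqP; split=> [x|_ [i _ <-]] /=; last by have := ltn_ord i; lia.
  case: x => // x; rewrite ltz_nat => /andP[_ xk]; by exists (Ordinal xk).
split; first by apply: finite_image; exact: finite_finset.
by rewrite set_card_range ?card_ord // => i j [/val_inj].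
Qed.

End SetCard.

(** * Determinants *)

Section LinearAlgebra.

(** Induction on the size: the leading entry a is positive, det A = a det S for the Schur complement
    S, and S inherits the hypothesis from A. *)
Lemma det_posdef (R : realFieldType) (g : nat) (A : 'M[R]_g) :
  (forall x : 'cV_g, x != 0 -> 0 < (x^T *m A *m x) 0 0) -> 0 < \det A.
Proof.
elim: g A => [|g IH] A posA; first by rewrite det_mx00.
move: A posA; rewrite -[g.+1]/(1 + g)%N => A posA.
have a_gt0 : 0 < ulsubmx A 0 0.
  have /posA : col_mx 1%:M 0 != 0 :> 'cV[R]_(1 + g).
    by rewrite col_mx_eq0 negb_and oner_neq0.
  rewrite -[A in _ *m A *m _]submxK tr_col_mx mul_row_block mul_row_col.
  by rewrite !(trmx0, trmx1, mul0mx, mulmx0, mul1mx, mulmx1, addr0).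
set a := ulsubmx A 0 0 in a_gt0.
have defa : ulsubmx A = a%:M by apply: mx11_scalar.
set b := ursubmx A; set c := dlsubmx A; set D := drsubmx A.
have defA : A = block_mx a%:M b c D by rewrite -defa submxK.
pose S := D - a^-1 *: (c *m b).
have detA : \det A = a * \det S.
  (* Row elimination: a unipotent lower triangular factor clears the block c. *)
  have /(congr1 (fun M => \det M)) :
      block_mx 1%:M 0 (- a^-1 *: c) 1%:M *m A = block_mx a%:M b 0 S.
    rewrite defA mulmx_block !mul1mx !mul0mx !addr0 -scalemxAl mul_mx_scalar.
    rewrite scalerA mulNr mulVf ?gt_eqF // scaleN1r addNr.
    by rewrite scaleNr mulNmx -scalemxAl addrC.
  by rewrite /= det_mulmx det_lblock det_ublock !det1 !mul1r det_scalar1.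
rewrite detA mulr_gt0 //; apply: IH => y y_neq0.
(* The first coordinate is chosen to kill the first row of A x. *)
pose x : 'cV[R]_(1 + g) := col_mx (- a^-1 *: (b *m y)) y.
have Ax : A *m x = col_mx 0 (S *m y).
  rewrite defA mul_block_col mul_scalar_mx scalerA mulrN mulfV ?gt_eqF //.
  rewrite scaleN1r addNr mulmxBl -scalemxAl -scalemxAr scaleNr mulmxA.
  by rewrite addrC.
have /posA : x != 0 by rewrite col_mx_eq0 negb_and y_neq0 orbT.
by rewrite -!mulmxA Ax tr_col_mx mul_row_col mulmx0 add0r.
Qed.

(** Write F = P D Q with P, Q invertible over the integers and D diagonal. The class of u is
    determined by the residues of P^-1 u modulo the diagonal entries of D, and these fill a box with
    |det F| points. *)
Lemma card_cokernel (g : nat) (F : 'M[int]_g) :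
  let cls (u : 'cV[int]_g) := [set u + F *m z | z in setT] in
  \det F != 0 ->
  finite_set (range cls) /\ set_card (range cls) = `|\det F|%N.
Proof.
move=> cls detF_neq0.
have [P uP [Q uQ [d _ defF]]] := int_Smith_normal_form F.
pose e i : int := d`_i.
set D := (X in P *m X *m Q) in defF.
have defD : D = diag_mx (\row_i e i).
  by apply/matrixP => i j; rewrite !mxE.
have unit_abs (M : 'M[int]_g) : M \in unitmx -> `|\det M|%N = 1%N.
  by rewrite unitmxE => /orP[] /eqP ->.
have absF : `|\det F|%N = (\prod_(i < g) `|e i|)%N.
  rewrite defF !det_mulmx !abszM (unit_abs _ uP) (unit_abs _ uQ) mul1n muln1.
  rewrite defD det_diag.
  rewrite (big_morph absz abszM absz1).
  by apply: eq_bigr => i _; rewrite mxE.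
have d_neq0 (i : 'I_g) : e i != 0.
  apply: contraNneq detF_neq0 => di0; rewrite -absz_eq0 absF.
  by rewrite (bigD1 i) //= di0 mul0n.
pose res (u : 'cV[int]_g) := [ffun i : 'I_g => ((invmx P *m u) i 0%R %% e i)%Z].
pose box (i : 'I_g) : set int := [set x : int | 0 <= x < (absz (e i))%:Z].
have res_range : range res = [set f : {ffun 'I_g -> int} | forall i, box i (f i)].
  apply/seteqP; split=> [_ [u _ <-] i|f fbox].
    by rewrite /box /= ffunE modz_ge0 // ltz_mod.
  exists (P *m \col_i f i) => //; apply/ffunP => i.
  rewrite ffunE mulKmx // mxE; have /andP[f0 fd] := fbox i.
  by rewrite -modz_abs modz_small // f0.
have boxP i : finite_set (box i) /\ set_card (box i) = absz (e i).
  exact: set_card_int_range.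
have [fin_res card_res] := set_card_prod (fun i : 'I_g => (boxP i).1).
(* u - v lies in the image of F exactly when D w = P^-1 (u - v) has an integer solution w, that is,
   when each diagonal entry divides the corresponding coordinate. *)
have cls_res u v : setT u -> setT v -> cls u = cls v <-> res u = res v.
  move=> _ _; transitivity (exists z, u = v + F *m z).
    split=> [eq_uv|[z ->]].
      have : cls u u by exists 0; rewrite // mulmx0 addr0.
      by rewrite eq_uv => -[z _ <-]; exists z.
    apply/seteqP; split=> [_ [y _ <-]|_ [y _ <-]].
      by exists (z + y); rewrite // mulmxDr addrA.
    by exists (y - z); rewrite // mulmxBr addrA addrAC addrK.
  have divD (w : 'cV_g) :
      (forall i, e i %| w i 0%R)%Z -> D *m (\col_i (w i 0%R %/ e i)%Z) = w.
    move=> dvd_w; apply/matrixP => i j; rewrite defD mul_diag_mx [j]ord1 !mxE.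
    by rewrite mulrC divzK.
  split=> [[z ->]|/ffunP eq_res].
    apply/ffunP => i; rewrite !ffunE mulmxDr mxE; apply/eqP.
    rewrite eqz_mod_dvd addrAC subrr add0r defF -!mulmxA mulKmx //.
    by rewrite defD mul_diag_mx !mxE dvdz_mulr.
  have dvd_uv i : (e i %| (invmx P *m (u - v)) i 0%R)%Z.
    rewrite mulmxBr.
    have -> (A B : 'cV[int]_g) : (A - B) i 0 = A i 0 - B i 0 by rewrite !mxE.
    rewrite -eqz_mod_dvd; apply/eqP.
    by have := eq_res i; rewrite !ffunE.
  exists (invmx Q *m \col_i ((invmx P *m (u - v)) i 0%R %/ e i)%Z).
  rewrite defF -!mulmxA mulKVmx //.
  by rewrite divD // mulKVmx // addrC subrK.
have := set_card_quotient cls_res; rewrite res_range => /(_ fin_res)[fin_cls ->].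
by rewrite card_res absF; split=> //; apply: eq_bigr => i _; rewrite (boxP i).2.
Qed.

End LinearAlgebra.

(** * Gram matrices and positivity of the determinants *)

Section Positivity.

Lemma sum_delta (N : nat) (R : pzRingType) (F : nat -> R) (a : nat) :
  (a < N)%N -> \sum_(t < N) (t == a :> nat)%:R * F t = F a.
Proof.
move=> aN; rewrite (bigD1 (Ordinal aN)) //= eqxx mul1r big1 ?addr0 // => t.
by rewrite -val_eqE /= => /negPf ->; rewrite mul0r.
Qed.

(* The coordinates of the simple root e_a - e_(a+1); the Cartan matrix is the
   Gram matrix of the simple roots. *)
Definition root_coord (a t : nat) : int := (t == a)%:R - (t == a.+1)%:R.

Lemma cartan_gram (n a b : nat) : (a < n)%N -> (b < n)%N ->
  cartan a b = \sum_(t < n.+1) root_coord a t * root_coord b t.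
Proof.
move=> an bn; under eq_bigr => t _ do rewrite {1}/root_coord mulrBl.
rewrite sumrB !sum_delta ?ltnS //; last exact: ltnW.
by rewrite /cartan /root_coord eqSS; lia.
Qed.

(** The minimum counts the s below both l and k: it is the inner product of the indicators of two
    initial segments. *)
Lemma minn_gram (N l k : nat) : (l <= N)%N ->
  (minn l k)%:Z = \sum_(s < N) (s < l)%N%:R * (s < k)%N%:R.
Proof.
elim: N l k => [|N IH] l k.
  by rewrite leqn0 => /eqP ->; rewrite big_ord0 min0n.
rewrite big_ord_recl; case: l k => [|l] [|k] lN; rewrite ?minn0 ?min0n ?minnSS.
- by rewrite /= mul0r add0r big1 // => i _; rewrite mul0r.
- by rewrite /= mul0r add0r big1 // => i _; rewrite mul0r.
- by rewrite /= mulr0 add0r big1 // => i _; rewrite mulr0.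
- by rewrite /= mulr1 -add1n PoszD (IH l k).
Qed.

Variables (n L : nat) (mu : 'I_n -> diagram).
Local Notation H := (Hbar mu).

(** [Cmin] is the Gram matrix of the vectors [v h], each the tensor product of the indicator of the
    s below [len h] with a simple root, so the form is a sum of squares. *)
Lemma Cmin_psd (y : H -> rat) :
  0 <= \sum_(h : H) \sum_(k : H) y h * (Cmin h k)%:~R * y k.
Proof.
pose N := (\max_(h : H) len h)%N.
pose v (h : H) (s t : nat) : rat := (s < len h)%N%:R * (root_coord (color h) t)%:~R.
have CminE (h k : H) :
    (Cmin h k)%:~R = \sum_(s < N) \sum_(t < n.+1) v h s t * v k s t.
  rewrite /Cmin (@cartan_gram n) // (@minn_gram N); last exact: leq_bigmax.
  rewrite mulrC big_distrlr /= rmorph_sum; apply: eq_bigr => s _.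
  rewrite rmorph_sum; apply: eq_bigr => t _.
  by rewrite /v !rmorphM /= !rmorph_nat; ring.
suff -> : \sum_(h : H) \sum_(k : H) y h * (Cmin h k)%:~R * y k =
    \sum_(s < N) \sum_(t < n.+1) (\sum_(h : H) y h * v h s t) ^+ 2.
  by apply: sumr_ge0 => s _; apply: sumr_ge0 => t _; apply: sqr_ge0.
transitivity (\sum_(h : H) \sum_(k : H) \sum_(s < N) \sum_(t < n.+1)
    (y h * v h s t) * (y k * v k s t)).
  apply: eq_bigr => h _; apply: eq_bigr => k _.
  rewrite CminE mulr_sumr mulr_suml; apply: eq_bigr => s _.
  by rewrite mulr_sumr mulr_suml; apply: eq_bigr => t _; ring.
under eq_bigr => h _.
  rewrite exchange_big; under eq_bigr => s _ do rewrite exchange_big.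
  over.
rewrite exchange_big; apply: eq_bigr => s _.
rewrite exchange_big; apply: eq_bigr => t _.
by rewrite expr2 big_distrlr.
Qed.

Lemma len_mem (h : H) : len h \in rows (mu (color h)).
Proof. by rewrite -mem_undup mem_nth. Qed.

Lemma len_gt0 (h : H) : (0 < len h)%N.
Proof.
have /andP[_] := rowsP (mu (color h)); rewrite lt0n; apply: contraNneq => <-.
exact: len_mem.
Qed.

Lemma len_inj (h k : H) : color h = color k -> len h = len k -> h = k.
Proof.
case: h k => [a i] [b j]; rewrite /len /color /= => eq_ab; subst b => /eqP.
by rewrite nth_uniq ?undup_uniq // => /eqP/val_inj ->.
Qed.

Lemma mult_gt0 (h : H) : (0 < mult h)%N.
Proof. by rewrite -has_count has_pred1 len_mem. Qed.

Hypothesis vac_gt0 : positive_vacancies L mu.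

Lemma nvacancyE (h : H) : (nvacancy L h)%:Z = vacancy L h.
Proof. by rewrite /nvacancy gez0_abs // (le_trans _ (vac_gt0 h)). Qed.

(* Scaling row h by m_h turns F into a symmetric matrix: a positive diagonal
   plus the form of Cmin_psd at (m_h x_h). *)
Lemma det_Fmx_gt0 : 0 < \det (Fmx L mu).
Proof.
pose W : 'M[rat]_#|H| := diag_mx (\row_i (mult (enum_val i))%:R).
pose A := W *m map_mx intr (Fmx L mu).
have detW : 0 < \det W.
  rewrite det_diag; apply: prodr_gt0 => i _; rewrite mxE ltr0n; exact: mult_gt0.
have : 0 < \det A; last first.
  by rewrite det_mulmx pmulr_rgt0 // det_map_mx ltr0z.
apply: det_posdef => x x_neq0; pose z (h : H) := x (enum_rank h) 0.
have -> : (x^T *m A *m x) 0 0 =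
    \sum_(h : H) \sum_(k : H) z h * ((mult h)%:R * (Fcoef L h k)%:~R) * z k.
  rewrite mxE exchange_big [RHS]big_enum_val; apply: eq_bigr => j _.
  rewrite mxE mulr_suml [RHS]big_enum_val; apply: eq_bigr => i _.
  by rewrite /A mul_diag_mx !mxE /z !enum_valK.
have -> : \sum_(h : H) \sum_(k : H) z h * ((mult h)%:R * (Fcoef L h k)%:~R) * z k
    = \sum_(h : H) (mult h)%:R * (vacancy L h)%:~R * z h ^+ 2 +
      \sum_(h : H) \sum_(k : H)
        (z h * (mult h)%:R) * (Cmin h k)%:~R * (z k * (mult k)%:R).
  rewrite -big_split /=; apply: eq_bigr => h _.
  rewrite (bigD1 h) //= [in RHS](bigD1 h) //= addrA; congr (_ + _).
    by rewrite /Fcoef eqxx mul1r rmorphD rmorphM /= -!pmulrn; ring.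
  apply: eq_bigr => k kh; rewrite /Fcoef eq_sym (negPf kh) mul0r add0r.
  by rewrite rmorphM /= -!pmulrn; ring.
apply: ltr_wpDr; first exact: Cmin_psd.
have term_ge0 (h : H) : 0 <= (mult h)%:R * (vacancy L h)%:~R * z h ^+ 2 :> rat.
  rewrite mulr_ge0 ?sqr_ge0 // mulr_ge0 ?ler0n // ler0z.
  exact: le_trans (vac_gt0 h).
have [i xi] : exists i, x i 0 != 0.
  apply/existsP; apply: contraNT x_neq0; rewrite negb_exists => /forallP x0.
  by apply/eqP/matrixP => i j; rewrite ord1 mxE; apply/eqP; rewrite -[_ == _]negbK.
rewrite (bigD1 (enum_val i)) //= ltr_pwDl ?sumr_ge0 //.
apply: mulr_gt0; last by rewrite exprn_even_gt0 //= /z enum_valK xi.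
apply: mulr_gt0; first by rewrite ltr0n mult_gt0.
by rewrite ltr0z; apply: lt_le_trans (vac_gt0 _).
Qed.

(** Column k of F is [gam k] times that of F_gamma. The divisions are exact since [gam k] divides
    both the vacancy number on the diagonal and the factor [mult k]. *)
Lemma det_Fgamma (gam : {ffun H -> nat}) : divisor_arrays L mu gam ->
  \det (Fmx L mu) = \det (Fgamma L gam) * (\prod_h gam h)%N%:Z.
Proof.
move=> div_gam.
have -> : Fmx L mu = Fgamma L gam *m diag_mx (\row_i (gam (enum_val i))%:Z).
  apply/matrixP => i j; rewrite mul_mx_diag !mxE divzK // rpredD //.
    have [->|_] := eqVneq (enum_val i) (enum_val j); last by rewrite mul0r rpred0.
    rewrite mul1r -nvacancyE dvdzE /=.
    by have [_ _] := div_gam (enum_val j).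
  apply: dvdz_mull; rewrite dvdzE /=.
  by have [] := div_gam (enum_val j).
rewrite det_mulmx det_diag; congr (_ * _).
under eq_bigr => i _ do rewrite mxE.
rewrite (big_morph Posz PoszM (erefl 1%:Z)) [RHS]big_enum_val.
by apply: eq_bigl => i.
Qed.

Lemma det_Fgamma_gt0 (gam : {ffun H -> nat}) : divisor_arrays L mu gam ->
  0 < \det (Fgamma L gam).
Proof.
move=> div_gam; have := det_Fmx_gt0; rewrite (det_Fgamma div_gam) pmulr_lgt0 //.
by rewrite ltz_nat prodn_gt0 // => h; have [] := div_gam h.
Qed.

End Positivity.

(** * Quasi-periodic sequences *)

Section QuasiPeriodic.

Lemma quasi_periodic_iter (f : int -> int) (m p : int) :
  (forall al, f (al + m) = f al + p) ->
  forall q al, f (al + q * m) = f al + q * p.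
Proof.
move=> fm; have nat_iter (q : nat) al : f (al + q%:Z * m) = f al + q%:Z * p.
  elim: q al => [|q IH] al; first by rewrite !mul0r !addr0.
  by rewrite -addn1 PoszD !mulrDl !mul1r !addrA fm IH.
move=> [q|q] al; first exact: nat_iter.
rewrite NegzE; apply: (addIr (q.+1%:Z * p)); rewrite -nat_iter.
by rewrite !mulNr !subrK.
Qed.

Lemma nondecreasing_int (f : int -> int) :
  (forall al, f al <= f (al + 1)) -> {homo f : x y / x <= y}.
Proof.
move=> f_nd x y xy; have -> : y = x + `|y - x|%N%:Z by lia.
elim: `|y - x|%N => [|k IH]; first by rewrite addr0.
by rewrite -addn1 PoszD addrA (le_trans IH).
Qed.

(** Division with remainder adapted to periods that occupy the positions 1, ..., m, as sequences are
    normalized at 1. *)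
Lemma int_divmod1 (m : nat) (al : int) : (0 < m)%N ->
  exists (q : int) (r : nat), (r < m)%N /\ al = 1 + r%:Z + q * m%:Z.
Proof.
move=> m_gt0; exists ((al - 1) %/ m%:Z)%Z, `|((al - 1) %% m%:Z)%Z|%N.
have m_neq0 : m%:Z != 0 by lia.
have := modz_ge0 (al - 1) m_neq0; have := ltz_mod (al - 1) m_neq0.
by have := divz_eq (al - 1) m%:Z; set q := (_ %/ _)%Z; set r := (_ %% _)%Z; lia.
Qed.

(** The list s gives the values at 1, ..., m, so its entry r is the value at 1 + r; each further
    period adds p. *)
Definition quasi_ext (m p : nat) (s : seq nat) : int -> int := fun al =>
  (nth 0%N s `|((al - 1) %% m%:Z)%Z|%N)%:Z + ((al - 1) %/ m%:Z)%Z * p%:Z.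

Lemma quasi_extE (m p : nat) (s : seq nat) (q : int) (r : nat) : (r < m)%N ->
  quasi_ext m p s (1 + r%:Z + q * m%:Z) = (nth 0%N s r)%:Z + q * p%:Z.
Proof.
move=> rm; rewrite /quasi_ext.
rewrite (_ : 1 + r%:Z + q * m%:Z - 1 = q * m%:Z + r%:Z); last ring.
have m_neq0 : m%:Z != 0 by lia.
by rewrite divzMDl // modzMDl modz_small ?divz_small ?addr0 //; lia.
Qed.

Lemma quasi_ext_Lambda (m p : nat) (s : seq nat) : size s = m ->
  sorted leq (0%N :: s) -> all (leq^~ p) s ->
  Lambda m.+1 p (quasi_ext m.+1 p (0%N :: s)).
Proof.
move=> sz_s sorted_s s_le_p.
have s_le (i : nat) : (i < m.+1)%N -> (nth 0%N (0%N :: s) i <= p)%N.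
  by case: i => [|i] // im; apply: (allP s_le_p (nth 0%N s i)); rewrite mem_nth ?sz_s.
split=> [|al|al].
- by have := @quasi_extE m.+1 p (0%N :: s) 0 0 isT; rewrite !mul0r !addr0.
- have [q [r [rm ->]]] := int_divmod1 al (ltn0Sn m); rewrite quasi_extE //.
  have [rm'|mr] := ltnP r.+1 m.+1.
    have -> : 1 + r%:Z + q * m.+1%:Z + 1 = 1 + r.+1%:Z + q * m.+1%:Z by lia.
    rewrite quasi_extE // lerD2r lez_nat.
    by apply: (sorted_leq_nth leq_trans leqnn); rewrite ?inE /= ?sz_s //.
  (* At the last position of a period the next value is the initial 0 raised by p, and all entries
     are at most p. *)
  have -> : 1 + r%:Z + q * m.+1%:Z + 1 = 1 + 0%N%:Z + (q + 1) * m.+1%:Z by lia.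
  by rewrite quasi_extE //= mulrDl; have := s_le _ rm; lia.
- have [q [r [rm ->]]] := int_divmod1 al (ltn0Sn m).
  have -> : 1 + r%:Z + q * m.+1%:Z + m.+1%:Z = 1 + r%:Z + (q + 1) * m.+1%:Z by ring.
  by rewrite !quasi_extE //; ring.
Qed.

(** The m values at 2, ..., m + 1 lie between the value 0 at 1 and the value p at m + 2, and
    determine the sequence. *)
Lemma Lambda_quasi_ext (m p : nat) (la : int -> int) : Lambda m.+1 p la ->
  exists2 t : m.-tuple 'I_p.+1, sorted leq (map val t) &
    la = quasi_ext m.+1 p (0%N :: map val t).
Proof.
move=> [la1 la_nd la_qp]; have la_mono := nondecreasing_int la_nd.
have la_ge0 (i : nat) : 0 <= la (i.+1%:Z) by rewrite -la1; apply: la_mono; lia.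
have la_le (i : nat) : (i < m.+1)%N -> la (i.+1%:Z) <= p%:Z.
  by move=> im; rewrite -[p%:Z]add0r -la1 -la_qp; apply: la_mono; lia.
pose t := [tuple inord `|la (i.+2)%:Z|%N | i < m] : m.-tuple 'I_p.+1.
have tE (i : nat) : (i < m)%N -> (nth 0%N (map val t) i)%:Z = la (i.+2)%:Z.
  move=> im; rewrite (nth_map ord0) ?size_tuple // -[i]/(val (Ordinal im)).
  rewrite -tnth_nth tnth_mktuple /= inordK; have := la_ge0 i.+1; first lia.
  by have := la_le i.+1 im; lia.
exists t.
  apply/(sortedP 0%N) => i; rewrite size_map size_tuple => im.
  by rewrite -lez_nat !tE //; [apply: la_mono; lia | exact: ltnW].
apply/funext => al; have [q [r [rm ->]]] := int_divmod1 al (ltn0Sn m).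
rewrite quasi_extE // (quasi_periodic_iter la_qp); congr (_ + _).
case: r rm => [|r] rm /=; first by rewrite addr0.
by rewrite tE // -PoszD.
Qed.

Lemma quasi_ext_inj (m p : nat) (s t : seq nat) : size s = m -> size t = m ->
  quasi_ext m p s = quasi_ext m p t -> s = t.
Proof.
move=> sz_s sz_t eq_st; apply: (@eq_from_nth _ 0%N); rewrite ?sz_s ?sz_t // => i im.
have := congr1 (fun f => f (1 + i%:Z + 0 * m%:Z)) eq_st.
by rewrite !quasi_extE // !mul0r !addr0 => -[].
Qed.

(** Apart from the value 0 at 1, a period is a nondecreasing sequence of m - 1 numbers in 0, ..., p,
    and such sequences are counted by the binomial. *)
Lemma card_Lambda (m p : nat) : (0 < m)%N ->
  finite_set (Lambda m p) /\ set_card (Lambda m p) = 'C((p + m).-1, m.-1).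
Proof.
case: m => // m _.
pose S := [set t : m.-tuple 'I_p.+1 | sorted leq (map val t)]%classic.
pose f (t : m.-tuple 'I_p.+1) := quasi_ext m.+1 p (0%N :: map val t).
have -> : Lambda m.+1 p = f @` S.
  apply/seteqP; split=> [la /Lambda_quasi_ext[t St ->]|_ [t St <-]]; first by exists t.
  apply: quasi_ext_Lambda; first by rewrite size_map size_tuple.
    by have {St}: sorted leq (map val t) := St; case: (map val t).
  by apply/allP => _ /mapP[i _ ->]; rewrite -ltnS ltn_ord.
have injf : {in S &, injective f}.
  move=> s t _ _ /quasi_ext_inj; rewrite /= !size_map !size_tuple.
  by move=> /(_ erefl erefl)[] /(inj_map val_inj)/val_inj.
split; first exact/finite_image/finite_finset.
rewrite (set_card_image finite_finset injf) set_card_pred.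
by rewrite -cardsE card_sorted_tuples addnS /= addnC.
Qed.

End QuasiPeriodic.

(** * Maximal divisors and cyclic shifts *)

Section LambdaGamma.

Variables (m p : nat).
Hypothesis m_gt0 : (0 < m)%N.

(** Running g times through the quasi-period (m / g, p / g) gives the quasi-period (m, p). *)
Lemma Lambda_divisor (g : nat) : (g %| m)%N -> (g %| p)%N ->
  Lambda (m %/ g) (p %/ g) `<=` Lambda m p.
Proof.
move=> gm gp la [la1 la_nd la_qp]; split=> // al.
have := quasi_periodic_iter la_qp g%:Z al.
by rewrite -!PoszM ![(g * _)%N]mulnC !divnK.
Qed.

(** Take the largest common divisor g with la in Lambda (m / g) (p / g): g = 1 is admissible, and
    every admissible g is at most m. *)
Lemma Lambda_gamma_ex (la : int -> int) : Lambda m p la ->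
  exists g, [/\ (0 < g)%N, (g %| m)%N, (g %| p)%N & Lambda_gamma g m p la].
Proof.
move=> Lla; pose P g :=
  [&& (g %| m)%N, (g %| p)%N & `[< Lambda (m %/ g) (p %/ g) la >]].
have exP : exists g, P g by exists 1%N; rewrite /P !dvd1n !divn1 /=; apply/asboolP.
have ubP g : P g -> (g <= m)%N by move=> /and3P[gm _ _]; apply: dvdn_leq.
case: (ex_maxnP exP ubP) => g /and3P[gm gp /asboolP Lg] max_g; exists g.
split=> //; first exact: dvdn_gt0 gm.
split=> // g' gg' g'm g'p Lg'; have : (g' <= g)%N.
  by apply: max_g; rewrite /P g'm g'p; apply/asboolP.
by rewrite leqNgt gg'.
Qed.

Lemma Lambda_gamma_inj (g g' : nat) (la : int -> int) :
  (g %| m)%N -> (g %| p)%N -> (g' %| m)%N -> (g' %| p)%N ->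
  Lambda_gamma g m p la -> Lambda_gamma g' m p la -> g = g'.
Proof.
move=> gm gp g'm g'p [Lg max_g] [Lg' max_g'].
by case: (ltngtP g g') => // [/max_g|/max_g'] [].
Qed.

(** Translation of the index, renormalized to vanish at 1: the effect of A on the coordinate
    [lambda]. *)
Definition shift (la : int -> int) (s : int) : int -> int :=
  fun al => la (al + s) - la (1 + s).

Definition shift_orbit (la : int -> int) : set (int -> int) := range (shift la).

Lemma shiftD la s t : shift (shift la s) t = shift la (t + s).
Proof. by apply/funext => al; rewrite /shift !addrA; ring. Qed.

Lemma shift0 la : la 1 = 0 -> shift la 0 = la.
Proof. by move=> la1; apply/funext => al; rewrite /shift !addr0 la1 subr0. Qed.

Lemma shift_orbitE la s : shift_orbit (shift la s) = shift_orbit la.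
Proof.
apply/seteqP; split=> [_ [t _ <-]|_ [t _ <-]].
  by exists (t + s); rewrite ?shiftD.
by exists (t - s); rewrite // shiftD subrK.
Qed.

Lemma shift_orbit_refl la : la 1 = 0 -> shift_orbit la la.
Proof. by move=> /shift0 la0; exists 0. Qed.

Lemma shift_Lambda k q la s : Lambda k q la -> Lambda k q (shift la s).
Proof.
move=> [la1 la_nd la_qp]; split=> [|al|al]; first by rewrite /shift subrr.
  by rewrite /shift lerD2r addrAC.
by rewrite /shift addrAC la_qp addrAC.
Qed.

(** The opposite shift would carry a larger admissible divisor of the shifted sequence back to
    la. *)
Lemma shift_Lambda_gamma g la s :
  Lambda_gamma g m p la -> Lambda_gamma g m p (shift la s).
Proof.
move=> [Lg max_g]; split=> [|g' gg' g'm g'p /(shift_Lambda (- s))].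
  exact: shift_Lambda.
by rewrite shiftD addNr shift0; [apply: max_g|case: Lg].
Qed.

(* If two shifts by s, t agree then la is also quasi-periodic with period
   e = gcd(s - t, m / g); for e < m / g this would contradict the maximality of
   the divisor g, as la would belong to Lambda (m / g') (p / g') with
   g' = m / e. *)
Lemma shift_eq g la s t : (g %| m)%N -> (g %| p)%N -> Lambda_gamma g m p la ->
  shift la s = shift la t <-> (s %% (m %/ g)%N%:Z)%Z = (t %% (m %/ g)%N%:Z)%Z.
Proof.
move=> gm gp [[la1 la_nd la_qp] max_g].
have g_gt0 : (0 < g)%N by apply: dvdn_gt0 gm.
set M := (m %/ g)%N in la_qp *; set P := (p %/ g)%N in la_qp *.
have M_gt0 : (0 < M)%N by rewrite divn_gt0 // dvdn_leq.
have defm : m = (g * M)%N by rewrite mulnC divnK.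
have defp : p = (g * P)%N by rewrite mulnC divnK.
have la_iter := quasi_periodic_iter la_qp.
split=> [eq_st|/eqP]; last first.
  rewrite eqz_mod_dvd => /dvdzP[k /eqP]; rewrite subr_eq => /eqP ->.
  apply/funext => al; rewrite /shift [k * _ + _]addrC !addrA !la_iter.
  by rewrite opprD addrACA subrr addr0.
apply/eqP; rewrite eqz_mod_dvd.
(* Comparing the two shifts at al - t shows that translation by s - t adds the constant c. *)
pose c := la (1 + s) - la (1 + t).
have la_c al : la (al + (s - t)) = la al + c.
  have := congr1 (fun f => f (al - t)) eq_st; rewrite /shift subrK /c.
  by rewrite (_ : al - t + s = al + (s - t)); [lia | ring].
(* The Bezout coefficients combine the quasi-periods s - t and M into e, with increment q. *)
have [u [v uv]] := Bezoutz (s - t) M%:Z.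
set e := gcdz _ _ in uv; pose q := u * c + v * P%:Z.
have la_e al : la (al + e) = la al + q.
  by rewrite -uv addrA la_iter (quasi_periodic_iter la_c) addrA.
have [k defM] : exists k : int, M%:Z = k * e by apply/dvdzP; apply: dvdz_gcdr.
have e_gt0 : 0 < e.
  by rewrite lt_neqAle eq_sym gcdz_eq0 negb_and; apply/andP; split => //; lia.
have q_ge0 : 0 <= q.
  by rewrite -(lerD2l (la 0)) -la_e addr0; apply: nondecreasing_int => //; lia.
have k_gt0 : 0 < k by rewrite -(pmulr_lgt0 _ e_gt0) -defM ltz_nat.
have defP : P%:Z = k * q.
  apply: (addrI (la 0)); rewrite -la_qp defM.
  by rewrite (quasi_periodic_iter la_e).
have k_le1 : k <= 1.
  rewrite leNgt; apply/negP => k_gt1.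
  (* k, e and q are nonnegative and become natural numbers; then g k = m / e is a common divisor of
     m and p larger than g. *)
  move: k_gt1 k_gt0 defM defP e_gt0 q_ge0 la_e; clearbody e q => {uv}.
  case: k => // k; case: e => // e; case: q => // q.
  move=> k1 k0 /eqP; rewrite -PoszM eqz_nat => /eqP defM /eqP.
  rewrite -PoszM eqz_nat => /eqP defP e0 q0 la_e.
  have kg_gt0 : (0 < g * k)%N by rewrite muln_gt0 g_gt0; lia.
  have m_gk : m = (e * (g * k))%N by rewrite defm defM; ring.
  have p_gk : p = (q * (g * k))%N by rewrite defp defP; ring.
  apply: (max_g (g * k)%N).
  - by rewrite -[X in (X < _)%N]muln1 ltn_pmul2l.
  - by rewrite m_gk dvdn_mull.
  - by rewrite p_gk dvdn_mull.
  - by rewrite m_gk p_gk !mulnK.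
have k1 : k = 1 by lia.
by move: defM; rewrite k1 mul1r => ->; apply: dvdz_gcdl.
Qed.

(** By [shift_eq] the orbit is in bijection with the residues modulo m / g. *)
Lemma card_shift_orbit g la : (g %| m)%N -> (g %| p)%N ->
  Lambda_gamma g m p la -> set_card (shift_orbit la) = (m %/ g)%N.
Proof.
move=> gm gp Lla; pose res (s : int) := (s %% (m %/ g)%N%:Z)%Z.
have M_gt0 : (0 < m %/ g)%N by rewrite divn_gt0 ?(dvdn_gt0 _ gm) // dvdn_leq.
have M_neq0 : (m %/ g)%N%:Z != 0 by lia.
have resE : range res = [set x : int | 0 <= x < (m %/ g)%N%:Z].
  apply/seteqP; split=> [_ [x _ <-]|x x_bnd]; first by rewrite /= modz_ge0 //= ltz_mod.
  by exists x; rewrite // /res modz_small.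
have [fin_res card_res] := set_card_int_range (m %/ g).
have eq_res s t : setT s -> setT t -> shift la s = shift la t <-> res s = res t.
  by move=> _ _; apply: shift_eq.
by have := set_card_quotient eq_res; rewrite resE => /(_ fin_res)[_ ->].
Qed.

Lemma finite_Lambda_gamma g : (g %| m)%N -> (g %| p)%N ->
  finite_set (Lambda_gamma g m p).
Proof.
move=> gm gp; apply: sub_finite_set (card_Lambda p m_gt0).1 => la [Lla _].
exact: Lambda_divisor Lla.
Qed.

Lemma card_shift_orbits g : (g %| m)%N -> (g %| p)%N ->
  set_card (Lambda_gamma g m p) =
    (set_card (shift_orbit @` Lambda_gamma g m p) * (m %/ g))%N.
Proof.
move=> gm gp; apply: set_card_blocks.
- exact: finite_Lambda_gamma.
- move=> la Lla; split; first by apply: shift_orbit_refl; case: Lla => [[]].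
  by move=> _ [s _ <-]; apply: shift_Lambda_gamma.
- by move=> la _ _ [s _ <-]; rewrite shift_orbitE.
- by move=> la; apply: card_shift_orbit.
Qed.

End LambdaGamma.

(** * Orbits of the time evolutions *)

(** Makes the linear extension [fglift f] available to the generic lemmas on additive maps. *)
HB.instance Definition _ (R : nzRingType) (K : choiceType) (M : lmodType R)
    (f : K -> M) :=
  GRing.isZmodMorphism.Build {freeg K / R} M (fglift f) (lift_is_additive f).

Section TimeEvolution.

Variables (n L : nat) (mu : 'I_n -> diagram).
Local Notation H := (Hbar mu).

Hypothesis vac_gt0 : positive_vacancies L mu.
Hypothesis lin : linearization_for L mu.

Lemma Pset_evolution (p : lpath n L) a k : Pset L mu p -> Pset L mu (evolution a k p).
Proof.
have [evoP _ _ _ _] := lin.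
by rewrite -[in X in _ -> X](evoP a k); exists p.
Qed.

Lemma Pset_evolution_inv (p : lpath n L) a k : Pset L mu p ->
  exists2 q, Pset L mu q & evolution a k q = p.
Proof.
have [evoP _ _ _ _] := lin.
by rewrite -[in X in X -> _](evoP a k) => -[q Pq <-]; exists q.
Qed.

Lemma Tact_path_Pset t p q : Tact_path mu t p q -> Pset L mu p /\ Pset L mu q.
Proof.
by elim=> [{}p|{}t {}p {}q a k _ [Pp Pq]|{}t {}p {}q a k Pq _ [Pp _]] //;
  split=> //; exact: Pset_evolution.
Qed.

Lemma Tact_path_trans t u (p q r : lpath n L) :
  Tact_path mu t p q -> Tact_path mu u q r -> Tact_path mu (t + u) p r.
Proof.
move=> pq qr; elim: qr pq => [{}q _|{}u {}q {}r a k _ IH|{}u {}q {}r a k Pr _ IH] pq.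
- by rewrite addr0.
- by rewrite addrA; apply: Tact_gen; apply: IH.
- by rewrite addrA; apply: Tact_inv => //; apply: IH.
Qed.

Lemma Torbit_refl p : Pset L mu p -> Torbit L mu p p.
Proof. by move=> Pp; exists 0; apply: Tact_one. Qed.

Lemma Torbit_trans p q r : Torbit L mu p q -> Torbit L mu q r -> Torbit L mu p r.
Proof. by move=> [t pq] [u qr]; exists (t + u); apply: Tact_path_trans qr. Qed.

Lemma Torbit_sym p q : Torbit L mu p q -> Torbit L mu q p.
Proof.
move=> [t]; elim=> [{}p Pp|{}t {}p {}q a k pq IH|{}t {}p {}q a k Pq pq IH].
- exact: Torbit_refl.
- apply: Torbit_trans IH; have [_ Pq] := Tact_path_Pset pq.
  by eexists; apply: Tact_inv => //; apply: Tact_one; apply: Pset_evolution.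
- apply: Torbit_trans IH.
  by eexists; apply: Tact_gen; apply: Tact_one.
Qed.

Lemma Torbit_eq p q : Torbit L mu p q -> Torbit L mu p = Torbit L mu q.
Proof.
move=> pq; apply/seteqP; split=> r; last exact: Torbit_trans.
by apply: Torbit_trans; apply: Torbit_sym.
Qed.

(** The t that act on all of P(mu) are closed under addition and contain the generators and,
    [evolution] being onto P(mu), their opposites; these generate the free group. *)
Lemma Tact_path_ex t (p : lpath n L) : Pset L mu p -> exists q, Tact_path mu t p q.
Proof.
pose total t := forall p, Pset L mu p -> exists q, Tact_path mu t p q.
have total0 : total 0 by move=> q Pq; exists q; apply: Tact_one.
have totalD u v : total u -> total v -> total (u + v).
  move=> tu tv q /tu[r qr]; have [_ Pr] := Tact_path_Pset qr.
  by have [s rs] := tv r Pr; exists s; apply: Tact_path_trans rs.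
have total_gen ak : total (Freeg [:: (1, ak)]).
  case: ak => a k q Pq; exists (evolution a k q).
  by rewrite -[Freeg _]add0r; apply: Tact_gen; apply: Tact_one.
have total_inv ak : total (- Freeg [:: (1, ak)]).
  case: ak => a k q Pq; have [r Pr rq] := Pset_evolution_inv a k Pq.
  exists r; rewrite -[- Freeg _]add0r; apply: Tact_inv => //.
  by rewrite rq; apply: Tact_one.
have total_nat u (c : nat) : total u -> total (u *+ c).
  by move=> tu; elim: c => [|c IH]; rewrite ?mulr0n // mulrS; apply: totalD.
have total_freeg : total t.
  rewrite -[t]freeg_sumE; elim: (dom t) => [|ak s IH].
    by rewrite big_nil.
  rewrite big_cons; apply: totalD => //.
  have -> (c : int) : Freeg [:: (c, ak)] = Freeg [:: (1, ak)] *~ c.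
    by rewrite freegU_mulz; congr (Freeg [:: (_, _)]); rewrite intz.
  case: (coeff ak t) => c; first exact: total_nat.
  by rewrite NegzE mulrNz -mulNrz; apply: total_nat.
exact: total_freeg.
Qed.

Lemma TshiftE (t : Tgroup n) : Tshift mu t = fglift (@hvec n mu) t.
Proof.
rewrite -[t in RHS]freeg_sumE raddf_sum; apply: eq_bigr => ak _.
by rewrite /= liftU.
Qed.

(* The second difference 2 h_l - h_(l-1) - h_(l+1) is the unit vector of the
   row length l, so that T acts transitively on Z^g. *)
Lemma Tshift_surj (u : 'cV[int]_#|H|) : exists t, Tshift mu t = u.
Proof.
pose gen (ak : 'I_n * nat) : Tgroup n := Freeg [:: (1, ak)].
(* Labels are shifted by one: for l = [len h] the three terms are T_l, T_(l+1) and T_(l-1), the last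
   one being absent for l = 1, where h_0 = 0. *)
pose unit_t (h : H) : Tgroup n :=
  gen (color h, (len h).-1) *+ 2 - gen (color h, len h) -
  (if (len h).-1 is k.+1 then gen (color h, k) else 0).
have lift_gen ak : fglift (@hvec n mu) (gen ak) = hvec mu ak.
  by rewrite liftU scale1r.
have unitE h i : fglift (@hvec n mu) (unit_t h) i 0 = (enum_val i == h)%:R.
  have l_gt0 := len_gt0 h.
  have [eq_c|ne_c] := eqVneq (color (enum_val i)) (color h); last first.
    have -> : (enum_val i == h) = false.
      by apply: contraNF ne_c => /eqP ->.
    rewrite /unit_t !raddfB /= raddfMn /= !lift_gen.
    by case: (len h).-1 => [|k]; rewrite ?raddf0 ?lift_gen !mxE (negPf ne_c).
  have -> : (enum_val i == h) = (len (enum_val i) == len h).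
    apply/eqP/eqP => [->//|]; exact: len_inj.
  rewrite /unit_t !raddfB /= raddfMn /= !lift_gen.
  case: (len h) l_gt0 => [//|[|k]] _ /=;
    rewrite ?raddf0 ?lift_gen !mxE eq_c eqxx /=; lia.
exists (\sum_(h : H) unit_t h *~ u (enum_rank h) 0).
rewrite TshiftE raddf_sum; apply/matrixP => i j; rewrite ord1 summxE.
rewrite (bigD1 (enum_val i)) //= big1 => [|h hi];
  rewrite raddfMz -scaler_int mxE unitE.
  by rewrite eqxx enum_valK intz mulr1 addr0.
by rewrite eq_sym (negPf hi) mulr0.
Qed.

(** * The action of A and the coordinates [lambda] *)

Lemma AactD (s s' : Agroup mu) r : Aact s (Aact s' r) = Aact (s + s') r.
Proof.
apply/funext => h; apply/funext => al; rewrite /Aact !ffunE -!addrA.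
rewrite -big_split; congr (_ + _).
by apply: eq_bigr => k _; rewrite ffunE mulrDl addrC.
Qed.

Lemma Aact0 r : Aact (0 : Agroup mu) r = r.
Proof.
apply/funext => h; apply/funext => al; rewrite /Aact ffunE addr0 big1 ?addr0 //.
by move=> k _; rewrite ffunE mul0r.
Qed.

Lemma Aorbit_refl (r : array mu) : Aorbit r r.
Proof. by exists 0; rewrite ?Aact0. Qed.

Lemma Aorbit_Aact (s : Agroup mu) r : Aorbit (Aact s r) = Aorbit r.
Proof.
apply/seteqP; split=> [_ [s' _ <-]|_ [s' _ <-]].
  by exists (s' + s); rewrite ?AactD.
by exists (s' - s); rewrite // AactD subrK.
Qed.

(** The actions of T and A commute, so T acts on A-orbits through representatives. *)
Lemma Tact_orbit_Aorbit t (r : array mu) :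
  Tact_orbit t (Aorbit r) = Aorbit (Tact_array t r).
Proof.
have TA s : Tact_array t (Aact s r) = Aact s (Tact_array t r).
  apply/funext => h; apply/funext => al; rewrite /Tact_array /Aact.
  by rewrite addrAC.
by rewrite /Tact_orbit /Aorbit image_comp; apply: eq_imagel => s _ /=.
Qed.

(** The constant added by [Aact] cancels in the difference with the value at 1. *)
Lemma lambda_Aact (s : Agroup mu) r h :
  lambda (Aact s r) h = shift (lambda r h) (s h).
Proof. by apply/funext => al; rewrite /lambda /shift /Aact; ring. Qed.

Lemma lambda_Tact t (r : array mu) h : lambda (Tact_array t r) h = lambda r h.
Proof. by apply/funext => al; rewrite /lambda /Tact_array; ring. Qed.

Lemma Jtilde_lambda (r : array mu) :
  Jtilde L r <-> forall h, Lambda (mult h) (nvacancy L h) (lambda r h).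
Proof.
split=> [Jr h|Lr h al].
  split=> [|al|al]; rewrite /lambda ?subrr //; have [r_nd r_qp] := Jr h al.
    by rewrite lerD2r.
  by rewrite r_qp nvacancyE // addrAC.
have [_ r_nd r_qp] := Lr h; split.
  by have := r_nd al; rewrite /lambda lerD2r.
have /eqP := r_qp al.
by rewrite /lambda addrAC (inj_eq (addIr _)) nvacancyE // => /eqP.
Qed.

Lemma Xgamma_lambda gam (r : array mu) : divisor_arrays L mu gam ->
  Xgamma L gam r <->
  forall h, Lambda_gamma (gam h) (mult h) (nvacancy L h) (lambda r h).
Proof.
move=> div_gam; split=> [[]//|Lr]; split=> //; apply/Jtilde_lambda => h.
by have [_ gm gp] := div_gam h; apply: (Lambda_divisor gm gp); case: (Lr h).
Qed.

Lemma Xgamma_Tact gam t (r : array mu) : divisor_arrays L mu gam ->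
  Xgamma L gam r -> Xgamma L gam (Tact_array t r).
Proof.
move=> div_gam /Xgamma_lambda Xr; apply/Xgamma_lambda => // h.
by rewrite lambda_Tact; apply: Xr.
Qed.

Lemma Phi_Tact t p q x : Tact_path mu t p q -> Phi L mu p = Aorbit x ->
  Phi L mu q = Aorbit (Tact_array t x).
Proof.
by have [_ _ _ _ comm] := lin; move=> /comm -> ->; rewrite Tact_orbit_Aorbit.
Qed.

(** * A complete invariant of the T-orbits and their number *)

Definition shift_orbits (r : array mu) : {ffun H -> set (int -> int)} :=
  [ffun h => shift_orbit (lambda r h)].

Lemma shift_orbits_Aact (s : Agroup mu) r :
  shift_orbits (Aact s r) = shift_orbits r.
Proof. by apply/ffunP => h; rewrite !ffunE lambda_Aact shift_orbitE. Qed.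

(** T fixes the coordinates [lambda] and A only shifts them. Conversely, an element of A matches the
    [lambda] of x with those of y, an element of T then matches [omega], and [Phi] is injective. *)
Lemma Torbit_shift_orbits p q x y :
  Pset L mu p -> Pset L mu q -> Phi L mu p = Aorbit x -> Phi L mu q = Aorbit y ->
  Torbit L mu p = Torbit L mu q <-> shift_orbits x = shift_orbits y.
Proof.
move=> Pp Pq Phip Phiq; split=> [eq_pq|/ffunP eq_xy].
  have [t /Phi_Tact/(_ Phip)] : Torbit L mu p q by rewrite eq_pq; apply: Torbit_refl.
  rewrite Phiq => eq_orb; have := Aorbit_refl y; rewrite eq_orb => -[s _ <-].
  rewrite shift_orbits_Aact; apply/ffunP => h.
  by rewrite !ffunE lambda_Tact.
have /choice[s sP] h : exists s, shift (lambda x h) s = lambda y h.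
  have := eq_xy h; rewrite !ffunE => eq_h.
  have : shift_orbit (lambda y h) (lambda y h).
    by apply: shift_orbit_refl; rewrite /lambda subrr.
  by rewrite -eq_h => -[s _ <-]; exists s.
pose x' := Aact [ffun h => s h] x.
(* x' already has the coordinates [lambda] of y; t corrects the values at 1. *)
have [t tP] := Tshift_surj (\col_i (y (enum_val i) 1 - x' (enum_val i) 1)).
have yE : y = Tact_array t x'.
  apply/funext => h; apply/funext => al; rewrite /Tact_array tP mxE enum_rankK.
  have : lambda y h al = lambda x' h al by rewrite lambda_Aact ffunE sP.
  by rewrite /lambda => /eqP; rewrite subr_eq => /eqP ->; ring.
have [q' pq'] := Tact_path_ex t Pp.
have -> : q = q'.
  have [_ Pq'] := Tact_path_Pset pq'.
  have [_ _ _ [_ Phi_inj _] _] := lin.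
  apply: Phi_inj; rewrite ?inE //.
  by rewrite (Phi_Tact pq' (x := x')) ?Aorbit_Aact // Phiq -yE.
by apply: Torbit_eq; exists t.
Qed.

Lemma Pgamma_Torbit gam p q : divisor_arrays L mu gam ->
  Pgamma L gam p -> Torbit L mu p q -> Pgamma L gam q.
Proof.
move=> div_gam [Pp [x Xx Phip]] [t pq]; split; first by have [] := Tact_path_Pset pq.
exists (Tact_array t x); first exact: Xgamma_Tact.
by rewrite (Phi_Tact pq (esym Phip)).
Qed.

(** The invariant takes every family of shift orbits as value, because [Phi] is onto J(mu). *)
Lemma card_Torbits gam : divisor_arrays L mu gam ->
  set_card (Torbit L mu @` Pgamma L gam) =
  (\prod_(h : H) set_card
     (shift_orbit @` Lambda_gamma (gam h) (mult h) (nvacancy L h)))%N.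
Proof.
move=> div_gam; pose D h :=
  shift_orbit @` Lambda_gamma (gam h) (mult h) (nvacancy L h).
have finD h : finite_set (D h).
  have [_ gm gp] := div_gam h; apply: finite_image.
  by apply: finite_Lambda_gamma => //; apply: mult_gt0.
have [fin_prod card_prod] := set_card_prod finD; rewrite -card_prod.
(* A representative of the A-orbit [Phi p]; the zero array is a default outside P_gamma(mu). *)
have /choice[rep repP] p : exists x, Pgamma L gam p ->
    Xgamma L gam x /\ Phi L mu p = Aorbit x.
  have [[Pp [x Xx Phip]]|nPp] := pselect (Pgamma L gam p); first by exists x.
  by exists (fun=> fun=> 0).
have img : (shift_orbits \o rep) @` Pgamma L gam =
    [set f : {ffun H -> set (int -> int)} | forall h, D h (f h)].
  apply/seteqP; split=> [_ [p /repP[[_ Xx] _] <-] h|f fD].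
    by rewrite ffunE; exists (lambda (rep p) h).
  have /choice[la laP] h : exists la, Lambda_gamma (gam h) (mult h) (nvacancy L h) la
      /\ shift_orbit la = f h by have [la] := fD h; exists la.
  (* The family la is itself an array, the one with [omega] = 0. *)
  have lambda_la h : lambda la h = la h.
    apply/funext => al; rewrite /lambda.
    by have [[[-> _ _] _] _] := laP h; rewrite subr0.
  have Xla : Xgamma L gam la.
    by apply/Xgamma_lambda => // h; rewrite lambda_la; case: (laP h).
  have [_ _ _ [_ _ Phi_surj] _] := lin.
  have [p Pp Phip] : (Phi L mu @` Pset L mu) (Aorbit la).
    by apply: Phi_surj; exists la => //; case: Xla.
  have Pgp : Pgamma L gam p by split=> //; exists la.
  exists p => //; have [_ Phip'] := repP p Pgp.
  have := Aorbit_refl (rep p); rewrite -Phip' Phip => -[s _ defx].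
  apply/ffunP => h; rewrite /= -defx shift_orbits_Aact ffunE lambda_la.
  by case: (laP h).
have eq_orb p q : Pgamma L gam p -> Pgamma L gam q ->
    Torbit L mu p = Torbit L mu q <->
    (shift_orbits \o rep) p = (shift_orbits \o rep) q.
  move=> Pp Pq; have [_ Phip] := repP _ Pp; have [_ Phiq] := repP _ Pq.
  by apply: Torbit_shift_orbits; [case: Pp|case: Pq| |].
by have := set_card_quotient eq_orb; rewrite img => /(_ fin_prod)[_ ->].
Qed.

Lemma card_TorbitsE gam : divisor_arrays L mu gam ->
  (set_card (Torbit L mu @` Pgamma L gam))%:R = orbit_count L gam.
Proof.
move=> div_gam; rewrite card_Torbits // natr_prod; apply: eq_bigr => h _.
have [g_gt0 gm gp] := div_gam h; have m_gt0 := mult_gt0 h.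
have M_neq0 : (mult h %/ gam h)%N%:R != 0 :> rat.
  by rewrite pnatr_eq0 -lt0n divn_gt0 // dvdn_leq.
rewrite (card_shift_orbits m_gt0 gm gp) natrM -[in X in _ / X](divnK gm).
rewrite natrM mulfK ?mulfK //.
by rewrite pnatr_eq0 -lt0n.
Qed.

(** For each h take the maximal divisor of the coordinate [lambda] of an array representing
    [Phi p]. *)
Lemma Pset_bigcup : Pset L mu = \bigcup_(gam in divisor_arrays L mu) Pgamma L gam.
Proof.
apply/seteqP; split=> [p Pp|p [gam _ []//]].
have [_ _ _ [PhiJ _ _] _] := lin; have [r Jr Phip] := PhiJ p Pp.
have /choice[g gP] h : exists g, [/\ (0 < g)%N, (g %| mult h)%N, (g %| nvacancy L h)%N
    & Lambda_gamma g (mult h) (nvacancy L h) (lambda r h)].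
  by apply: Lambda_gamma_ex; [apply: mult_gt0|apply/Jtilde_lambda: h].
exists [ffun h => g h]; first by move=> h; rewrite ffunE; have [] := gP h.
split=> //; exists r => //; split=> // h; rewrite ffunE.
by have [] := gP h.
Qed.

(** Two representatives of one A-orbit differ by shifts in [lambda], which preserve the maximal
    divisors. *)
Lemma Pgamma_disjoint gam gam' p :
  divisor_arrays L mu gam -> divisor_arrays L mu gam' ->
  Pgamma L gam p -> Pgamma L gam' p -> gam = gam'.
Proof.
move=> div_gam div_gam' [_ [x [_ Xx] Phip]] [_ [y [_ Xy] Phip']].
have := Aorbit_refl x; rewrite Phip -Phip' => -[s _ defx].
apply/ffunP => h; have [_ gm gp] := div_gam h; have [_ g'm g'p] := div_gam' h.
apply: (Lambda_gamma_inj gm gp g'm g'p (Xx h)); rewrite -defx lambda_Aact.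
exact: shift_Lambda_gamma.
Qed.

(** * Orbit sizes and the size of P(mu) *)

Hypothesis tor : torus_for L mu.

(** The orbit is in bijection with the cokernel of F_gamma, and positivity removes the absolute
    value from |det F_gamma|. *)
Lemma card_Torbit gam p : divisor_arrays L mu gam -> Pgamma L gam p ->
  (set_card (Torbit L mu p))%:Z = \det (Fgamma L gam).
Proof.
move=> div_gam Pp; have [_ [x Xx Phip]] := Pp.
have [bij_chi _] := tor div_gam Pp Xx (esym Phip).
rewrite (set_card_bij finite_finset bij_chi).
have det_gt0 := det_Fgamma_gt0 vac_gt0 div_gam.
have [|_ ->] := card_cokernel (F := Fgamma L gam); first by rewrite gt_eqF.
by rewrite gtz0_abs.
Qed.

Lemma finite_divisor_arrays : finite_set (divisor_arrays L mu).
Proof.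
pose N := (\max_(h : H) mult h)%N.
pose f (g : {ffun H -> 'I_N.+1}) : {ffun H -> nat} := [ffun h => val (g h)].
apply: (@sub_finite_set _ _ (range f)); last exact/finite_image/finite_finset.
move=> gam div_gam; exists [ffun h => inord (gam h)] => //.
apply/ffunP => h; rewrite !ffunE /= inordK // ltnS.
have [_ gm _] := div_gam h; apply: leq_trans (dvdn_leq (mult_gt0 h) gm) _.
exact: leq_bigmax.
Qed.

(** P(mu) is partitioned into the P_gamma(mu), and each of these into orbits of det F_gamma
    elements. *)
Lemma card_Pset : (set_card (Pset L mu))%:R =
  \sum_(gam \in divisor_arrays L mu)
     (\det (Fgamma L gam))%:~R * orbit_count L gam.
Proof.
rewrite (set_card_bigcup finite_finset finite_divisor_arrays Pset_bigcup); last first.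
  by move=> gam gam' p; apply: Pgamma_disjoint.
rewrite !fsbig_finite; try exact: finite_divisor_arrays.
rewrite natr_sum big_seq [RHS]big_seq; apply: eq_bigr => gam.
rewrite in_fset_set; last exact: finite_divisor_arrays.
rewrite inE => div_gam.
rewrite -card_TorbitsE //.
rewrite (@set_card_blocks _ _ (Torbit L mu) `|\det (Fgamma L gam)|%N).
- rewrite natrM mulrC -[in RHS](gtz0_abs (det_Fgamma_gt0 vac_gt0 div_gam)).
  by rewrite -pmulrn.
- exact: finite_finset.
- move=> p Pp; split; first by apply: Torbit_refl; case: Pp.
  by move=> q; apply: Pgamma_Torbit.
- by move=> p q _; apply: Torbit_eq.
- by move=> p Pp; rewrite -(card_Torbit div_gam Pp) absz_nat.
Qed.

End TimeEvolution.

(** * Evaluation of the sum over gamma *)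

(** The families in the product of the sets Lambda are sorted by the maximal divisors of their
    components. In the term of gamma, det F = det F_gamma prod gamma turns the factors 1/m into the
    gamma/m of [orbit_count]. *)
Lemma OmegaE (n L : nat) (mu : 'I_n -> diagram) : positive_vacancies L mu ->
  Omega L mu = \sum_(gam \in divisor_arrays L mu)
    (\det (Fgamma L gam))%:~R * orbit_count L gam.
Proof.
move=> vac_gt0; pose La (h : Hbar mu) := Lambda (mult h) (nvacancy L h).
have cardLa (h : Hbar mu) := card_Lambda (nvacancy L h) (mult_gt0 h).
have [fin_prod card_prod] := set_card_prod (fun h : Hbar mu => (cardLa h).1).
pose Lg (gam : {ffun Hbar mu -> nat}) :=
  [set f : {ffun Hbar mu -> int -> int} |
     forall h, Lambda_gamma (gam h) (mult h) (nvacancy L h) (f h)].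
have prodU : [set f : {ffun Hbar mu -> int -> int} | forall h, La h (f h)] =
    \bigcup_(gam in divisor_arrays L mu) Lg gam.
  apply/seteqP; split=> [f fL|f [gam div_gam fL] h]; last first.
    by have [_ gm gp] := div_gam h; apply: (Lambda_divisor gm gp); case: (fL h).
  have /choice[g gP] h : exists g, [/\ (0 < g)%N, (g %| mult h)%N,
      (g %| nvacancy L h)%N & Lambda_gamma g (mult h) (nvacancy L h) (f h)].
    by apply: Lambda_gamma_ex; [apply: mult_gt0|apply: fL].
  by exists [ffun h => g h] => h; rewrite ffunE; have [] := gP h.
have disj gam gam' f : divisor_arrays L mu gam -> divisor_arrays L mu gam' ->
    Lg gam f -> Lg gam' f -> gam = gam'.
  move=> div_gam div_gam' fg fg'; apply/ffunP => h.
  have [_ gm gp] := div_gam h; have [_ g'm g'p] := div_gam' h.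
  exact: Lambda_gamma_inj gm gp g'm g'p (fg h) (fg' h).
have fin_div := finite_divisor_arrays L mu.
have := set_card_bigcup fin_prod fin_div prodU disj.
rewrite card_prod fsbig_finite // => /(congr1 (fun k : nat => k%:R : rat)).
rewrite natr_sum natr_prod => sum_Lg.
have m_prod : \prod_(h : Hbar mu) (mult h)%:R != 0 :> rat.
  by apply/prodf_neq0 => h _; rewrite pnatr_eq0 -lt0n mult_gt0.
(* The binomials are read back as sizes of the sets Lambda, whose product is the sum over gamma. *)
rewrite /Omega big_split /= -(eq_bigr _ (fun h _ => congr1 _ (cardLa h).2)) sum_Lg.
rewrite fsbig_finite // !mulr_sumr big_seq [RHS]big_seq; apply: eq_bigr => gam.
rewrite in_fset_set // inE => div_gam.
have gam_prod : \prod_(h : Hbar mu) (gam h)%:R != 0 :> rat.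
  by apply/prodf_neq0 => h _; rewrite pnatr_eq0 -lt0n; have [] := div_gam h.
have finLg h : finite_set (Lambda_gamma (gam h) (mult h) (nvacancy L h)).
  have [_ gm gp] := div_gam h; exact: (finite_Lambda_gamma (mult_gt0 h) gm gp).
rewrite (set_card_prod finLg).2.
rewrite (det_Fgamma vac_gt0 div_gam) intrM -pmulrn natr_prod natr_prod.
rewrite /orbit_count !prodf_div prodfV.
by field; rewrite m_prod gam_prod.
Qed.

Theorem theorem3p1 (n L : nat) (hn : (1 <= n)%N) (hL : (1 <= L)%N)
    (hlin : linearization_conjecture n L) (htor : torus_conjecture n L)
    (mu : 'I_n -> diagram) (hmu : positive_vacancies L mu) :
  [/\ (set_card (Pset L mu))%:R = Omega L mu,
      Omega L mu =
        \sum_(gam \in divisor_arrays L mu)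
          (\det (Fgamma L gam))%:~R * orbit_count L gam &
      forall gam : {ffun Hbar mu -> nat}, divisor_arrays L mu gam ->
        (forall p, Pgamma L gam p ->
           (set_card (Torbit L mu p))%:Z = \det (Fgamma L gam)) /\
        (set_card (Torbit L mu @` Pgamma L gam))%:R = orbit_count L gam].
Proof.
have lin := hlin mu hmu; have tor := htor mu hmu; split.
- by rewrite OmegaE // card_Pset.
- exact: OmegaE.
- move=> gam div_gam; split; last exact: card_TorbitsE.
  by move=> p; apply: (card_Torbit hmu tor).
Qed.
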